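(* A map $\Psi:\mathrm{Conv}(\mathbb{R},\mathbb{R})\to\mathrm{Conv}(\mathbb{R},\mathbb{R})$ is continuous and additive if and only if there exists $\psi\in C(\mathbb{R}^2)$ such that $$\Psi(f)[x]=(\partial_y^2\psi(x,\cdot))(f),\qquad x\in\mathbb{R},$$ for every $f\in\mathrm{Conv}(\mathbb{R},\mathbb{R})\cap C^2(\mathbb{R})$, where $\psi$ has the following properties: (1) $\psi(\cdot,y)$ is convex for every $y\in\mathbb{R}$. (2) For every compact subset $A\subset\mathbb{R}$ there exists $R=R(A)>0$ such that (a) $\mathrm{supp}\,\partial_x^2\psi(\cdot,y)\cap A=\emptyset$ for all $y\in\mathbb{R}\setminus[-R,R]$; (b) $\mathrm{supp}\,\partial_y^2\psi(x,\cdot)\subseteq[-R,R]$ for all $x\in A$. Moreover, $\Psi$ is monotone if and only if $\psi(x,\cdot)$ is convex for every $x\in\mathbb{R}$.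
   Context: $\mathrm{Conv}(\mathbb{R},\mathbb{R})$ is the set of all convex functions $f:\mathbb{R}\to\mathbb{R}$, with the topology induced by epi-convergence: $f_j$ epi-converges to $f$ if for every $x$ (i) $f(x)\le\liminf_j f_j(x_j)$ for every sequence $x_j\to x$, and (ii) there is a sequence $x_j\to x$ with $f(x)=\lim_j f_j(x_j)$ (for finite convex functions this is equivalent to locally uniform convergence). Continuity of $\Psi$ refers to this topology. $\Psi(f)[x]$ denotes the value of $\Psi(f)$ at $x$. $\Psi$ is additive if $\Psi(g+h)=\Psi(g)+\Psi(h)$ for all $g,h$, and monotone if $f\le g$ pointwise implies $\Psi(f)\le\Psi(g)$ pointwise. All partial derivatives are in the sense of distributions: for continuous $g:\mathbb{R}\to\mathbb{R}$, $\partial^2g$ is the distribution $(\partial^2g)(\phi)=\int_{\mathbb{R}}\phi''(y)g(y)\,dy$, $\phi\in C_c^\infty(\mathbb{R})$; $\partial_y^2\psi(x,\cdot)$ is this distribution for $g=\psi(x,\cdot)$ and $\partial_x^2\psi(\cdot,y)$ for $g=\psi(\cdot,y)$. By property (2b) $\partial_y^2\psi(x,\cdot)$ has compact support, so it can be applied to any $f\in C^2(\mathbb{R})$: $(\partial_y^2\psi(x,\cdot))(f)=\int_{\mathbb{R}}(\chi f)''(y)\psi(x,y)\,dy$ for any $\chi\in C_c^\infty(\mathbb{R})$ equal to $1$ on a neighborhood of the support.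
   Formalization: The literal ''if'' fails, as the formula does not constrain Ψ off C² (ψ=0, Ψ(f)=1 for f not C²). Proved instead: each ψ with (1),(2) gives a continuous additive Ψ satisfying the formula, and it is the only continuous map satisfying it. *)

(* Defs.v *)
(* Real analysis over the Stdlib reals R, with Coquelicot. *)
From Stdlib Require Import Reals Rtopology Lra.
From Coquelicot Require Import Coquelicot.
Open Scope R_scope.

Definition convex_fun (f : R -> R) : Prop :=
  forall x y t, 0 <= t <= 1 ->
    f (t * x + (1 - t) * y) <= t * f x + (1 - t) * f y.

Record Conv : Type := mkConv {
  conv_fun :> R -> R;
  conv_fun_convex : convex_fun conv_fun
}.

Lemma convex_fun_plus (f g : R -> R) :
  convex_fun f -> convex_fun g -> convex_fun (fun x => f x + g x).
Proof.
intros Hf Hg x y t Ht.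
specialize (Hf x y t Ht); specialize (Hg x y t Ht); lra.
Qed.

Definition conv_add (g h : Conv) : Conv :=
  mkConv (fun x => g x + h x)
    (convex_fun_plus g h (conv_fun_convex g) (conv_fun_convex h)).

Definition epi_converges (fs : nat -> Conv) (f : Conv) : Prop :=
  forall x : R,
    (forall xs : nat -> R, is_lim_seq xs x ->
       Rbar_le (f x) (LimInf_seq (fun j => fs j (xs j)))) /\
    (exists xs : nat -> R,
       is_lim_seq xs x /\ is_lim_seq (fun j => fs j (xs j)) (f x)).

(* The topology induced by epi-convergence: a set is open when every sequence
   epi-converging to one of its points eventually lies in it. *)
Definition epi_open (U : Conv -> Prop) : Prop :=
  forall (fs : nat -> Conv) (f : Conv),
    U f -> epi_converges fs f -> eventually (fun j => U (fs j)).

Definition epi_continuous (Psi : Conv -> Conv) : Prop :=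
  forall U : Conv -> Prop, epi_open U -> epi_open (fun f => U (Psi f)).

Definition additive (Psi : Conv -> Conv) : Prop :=
  forall (g h : Conv) (x : R), Psi (conv_add g h) x = Psi g x + Psi h x.

Definition monotone (Psi : Conv -> Conv) : Prop :=
  forall f g : Conv, (forall x, f x <= g x) -> forall x, Psi f x <= Psi g x.

(* [ex_derive_n f 2] only asks that the total function [Derive f] be
   differentiable, so differentiability of f itself is a separate clause. *)
Definition C2 (f : R -> R) : Prop :=
  (forall x, ex_derive f x) /\
  (forall x, ex_derive_n f 2 x) /\
  (forall x, continuous (Derive_n f 2) x).

Definition fun_supp (phi : R -> R) : R -> Prop :=
  adherence (fun y => phi y <> 0).

Definition test_fun (phi : R -> R) : Prop :=
  (forall n x, ex_derive_n phi n x) /\ compact (fun_supp phi).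

(* The second distributional derivative of a continuous g. The same formula is
   used below for compactly supported phi that are only of class C^2. The
   integrand is continuous with compact support, so the integral exists. *)
Definition dist_d2 (g : R -> R) (phi : R -> R) : R :=
  RInt_gen (fun y => Derive_n phi 2 y * g y)
    (Rbar_locally m_infty) (Rbar_locally p_infty).

(* The support of a distribution: the complement of the union of all open sets
   on which it vanishes. *)
Definition dist_supp (T : (R -> R) -> R) (x : R) : Prop :=
  forall U : R -> Prop, open_set U -> U x ->
    exists phi, test_fun phi /\ included (fun_supp phi) U /\ T phi <> 0.

Definition cutoff (K : R -> Prop) (chi : R -> R) : Prop :=
  test_fun chi /\
  exists U : R -> Prop,
    open_set U /\ included K U /\ forall y, U y -> chi y = 1.

(* v is the value at f, of class C^2, of the distribution [dist_d2 g], whose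
   support has to be compact (otherwise there is no cutoff function). *)
Definition dist_d2_value (g f : R -> R) (v : R) : Prop :=
  (exists chi, cutoff (dist_supp (dist_d2 g)) chi) /\
  (forall chi, cutoff (dist_supp (dist_d2 g)) chi ->
     v = dist_d2 g (fun y => chi y * f y)).

Definition admissible (psi : R -> R -> R) : Prop :=
  (forall x y, continuity_2d_pt psi x y) /\
  (forall y, convex_fun (fun x => psi x y)) /\
  (forall A : R -> Prop, compact A ->
     exists r : R, 0 < r /\
       (forall y, ~ (- r <= y <= r) ->
          forall x, A x -> ~ dist_supp (dist_d2 (fun z => psi z y)) x) /\
       (forall x, A x ->
          forall y, dist_supp (dist_d2 (psi x)) y -> - r <= y <= r)).

Definition represents (psi : R -> R -> R) (Psi : Conv -> Conv) : Prop :=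
  forall f : Conv, C2 f -> forall x : R, dist_d2_value (psi x) f (Psi f x).

(* Main.v *)
Require Import Defs.
From Stdlib Require Import Reals Rtopology Lra Lia Factorial Classical ClassicalEpsilon FunctionalExtensionality.
From Coquelicot Require Import Coquelicot.
Open Scope R_scope.

(** For finite convex functions epi-convergence is pointwise convergence
    ([epi_converges_pointwise]), so [Psi] is continuous exactly when each functional
    $T_x(f)=\Psi(f)[x]$ is sequentially continuous for pointwise limits.

    Existence of the kernel. Every convex $C^2$ function is, on a given interval, an affine
    function plus $\int f''(y)\,(t-y)_+\,dy$, so an additive continuous $T_x$ is determined by
    its values on hinges, and one takes $\psi(x,y)=T_x((\cdot-y)_+)$. Additivity and continuity
    give homogeneity, then compatibility with the integral ([functional_integral]). Functions
    that vanish on larger and larger intervals tend to zero pointwise even when multiplied by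
    arbitrarily large factors; hence [Psi] sends those that vanish on a sufficiently large
    interval to functions vanishing on a given compact set ([locality]). Hinges with a distant
    kink are affine up to such functions, so $\psi$ is affine in each variable for large $|y|$,
    which is the condition on supports.

    Distributions are reduced to calculus by one fact: a continuous [g] is affine near a point
    if and only if the point is outside the support of its second derivative
    ([loc_affine_of_not_supp], [loc_affine_outside_supp]). Off the support of [g''],
    $u''g$ is the derivative of $u'g-ug'$, and therefore the value of the distribution at [f]
    is $\int_{-M}^{M}f''g$ minus the boundary terms of that primitive, for every cutoff
    function and every large [M] ([pairing_value]).

    Existence of the map. For general convex [f] the integral makes no sense, since $f''$ is
    only a measure. Replacing [g] by a piecewise affine interpolation turns the pairing into a
    finite combination of values of [f], with an error at most $\varepsilon(f'(M)-f'(-M))$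
    ([pairing_approx]). Such combinations are continuous on all of [Conv], and since the $C^2$
    functions are dense ([mollify_lim]) they converge there to a continuous additive extension
    ([extension]), which is unique for the same reason. Convexity in [x] holds because
    $f''\ge0$ weights the convex functions $\psi(\cdot,y)$ and the boundary terms are affine in
    [x] ([pairing_convex]).

    Monotonicity. If $\psi(x,\cdot)$ is convex its second derivative is a positive distribution
    ([dist_d2_nonneg]), and smoothing preserves the order. Conversely, a smoothed hat is a
    difference of two ordered smooth convex functions, and its values under the distribution
    converge to a second difference of $\psi(x,\cdot)$ ([convex_of_monotone]). *)

(** * Convex functions and epi-convergence *)

Lemma convex3 (f : R -> R) (a m b : R) :
  convex_fun f -> a <= m <= b -> (b - a) * f m <= (b - m) * f a + (m - a) * f b.
Proof.
intros Hf Hm.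
destruct (Req_dec a b) as [->|Hab].
{ replace m with b by lra. lra. }
assert (Hp : 0 < b - a) by lra.
assert (Ht : 0 <= (b - m) / (b - a) <= 1).
{ split.
  - apply Rmult_le_pos; [lra | left; apply Rinv_0_lt_compat; lra].
  - apply (Rmult_le_reg_r (b - a)); [lra|]. field_simplify; lra. }
assert (H := Hf a b _ Ht).
replace ((b - m) / (b - a) * a + (1 - (b - m) / (b - a)) * b) with m in H by (field; lra).
apply (Rmult_le_compat_l (b - a)) in H; [|lra].
replace ((b - a) * ((b - m) / (b - a) * f a + (1 - (b - m) / (b - a)) * f b))
  with ((b - m) * f a + (m - a) * f b) in H by (field; lra).
exact H.
Qed.

Lemma convex3_intro (f : R -> R) :
  (forall a m b, a < m < b -> (b - a) * f m <= (b - m) * f a + (m - a) * f b) ->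
  convex_fun f.
Proof.
intros H.
(* convexity for x < y, from which the general case follows by symmetry *)
assert (Hlt : forall x y t, x < y -> 0 < t < 1 ->
   f (t * x + (1 - t) * y) <= t * f x + (1 - t) * f y).
{ intros x y t Hxy Ht.
  assert (H0 : x < t * x + (1 - t) * y < y) by nra.
  specialize (H x _ y H0).
  apply (Rmult_le_reg_l (y - x)); [lra|]. nra. }
intros x y t Ht.
destruct (Req_dec t 0) as [->|Ht0].
{ replace (0 * x + (1 - 0) * y) with y by ring. lra. }
destruct (Req_dec t 1) as [->|Ht1].
{ replace (1 * x + (1 - 1) * y) with x by ring. lra. }
destruct (Rtotal_order x y) as [Hxy|[->|Hxy]].
- apply Hlt; lra.
- replace (t * y + (1 - t) * y) with y by ring. lra.
- assert (H1 := Hlt y x (1 - t) Hxy ltac:(lra)).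
  replace ((1 - t) * y + (1 - (1 - t)) * x) with (t * x + (1 - t) * y) in H1 by ring.
  lra.
Qed.

(** The slope from [x] to a nearer point lies between the slopes over the two unit
    intervals adjacent to [x]. *)
Lemma convex_local_lipschitz (f : R -> R) (x h : R) :
  convex_fun f -> Rabs h <= 1 ->
  Rabs (f (x + h) - f x) <= Rabs h * (Rabs (f (x + 1) - f x) + Rabs (f (x - 1) - f x)).
Proof.
intros Hf Hh.
assert (A1 := Rle_abs (f (x + 1) - f x)).
assert (A2 := Rle_abs (f (x - 1) - f x)).
assert (A3 := Rabs_pos (f (x + 1) - f x)).
assert (A4 := Rabs_pos (f (x - 1) - f x)).
set (u := Rabs (f (x + 1) - f x)) in *.
set (v := Rabs (f (x - 1) - f x)) in *.
destruct (Rle_dec 0 h) as [Hp|Hn].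
- rewrite (Rabs_pos_eq h) in * by lra.
  assert (H1 := convex3 f x (x + h) (x + 1) Hf ltac:(lra)).
  assert (H2 := convex3 f (x - 1) x (x + h) Hf ltac:(lra)).
  apply Rabs_le; nra.
- rewrite (Rabs_left h) in * by lra.
  assert (H1 := convex3 f (x - 1) (x + h) x Hf ltac:(lra)).
  assert (H2 := convex3 f (x + h) x (x + 1) Hf ltac:(lra)).
  apply Rabs_le; nra.
Qed.

Lemma is_lim_seq_eps (u : nat -> R) (l : R) :
  (forall eps, 0 < eps -> eventually (fun n => Rabs (u n - l) < eps)) <-> is_lim_seq u l.
Proof.
split.
- intros H. apply is_lim_seq_spec. intros eps. apply H, cond_pos.
- intros H eps He. apply is_lim_seq_spec in H. exact (H (mkposreal eps He)).
Qed.

(** The local Lipschitz constants at [x] are bounded by values at [x - 1], [x] and [x + 1],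
    so they stay bounded along a pointwise convergent sequence. *)
Lemma convex_lim_seq (fs : nat -> R -> R) (f : R -> R) (xs : nat -> R) (x : R) :
  (forall n, convex_fun (fs n)) ->
  (forall y, is_lim_seq (fun n => fs n y) (f y)) ->
  is_lim_seq xs x -> is_lim_seq (fun n => fs n (xs n)) (f x).
Proof.
intros Hc Hf Hx.
assert (Hd : is_lim_seq (fun n => Rabs (xs n - x)) 0).
{ apply (proj1 (is_lim_seq_abs_0 (fun n => xs n - x))). replace (Finite 0) with (Finite (x - x)) by (f_equal; ring).
  apply is_lim_seq_minus'; [exact Hx | apply is_lim_seq_const]. }
assert (Hb : is_lim_seq (fun n => Rabs (xs n - x) *
    (Rabs (fs n (x + 1) - fs n x) + Rabs (fs n (x - 1) - fs n x))) 0).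
{ replace (Finite 0) with (Finite (0 * (Rabs (f (x + 1) - f x) + Rabs (f (x - 1) - f x))))
    by (f_equal; ring).
  apply is_lim_seq_mult'; [exact Hd|].
  apply is_lim_seq_plus';
    (apply is_lim_seq_abs with (l := Finite _); apply is_lim_seq_minus'; apply Hf). }
assert (Hz : is_lim_seq (fun n => fs n (xs n) - fs n x) 0).
{ apply (proj2 (is_lim_seq_abs_0 _)).
  apply is_lim_seq_le_le_loc with (u := fun _ => 0) (w := fun n => Rabs (xs n - x) *
    (Rabs (fs n (x + 1) - fs n x) + Rabs (fs n (x - 1) - fs n x))).
  - apply is_lim_seq_eps with (eps := 1) in Hd; [|lra].
    destruct Hd as [N HN]. exists N. intros n Hn. split; [apply Rabs_pos|].
    specialize (HN n Hn).
    replace (xs n) with (x + (xs n - x)) at 1 by ring.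
    apply convex_local_lipschitz; [apply Hc|].
    rewrite Rminus_0_r, Rabs_Rabsolu in HN. lra.
  - apply is_lim_seq_const.
  - exact Hb. }
replace (f x) with (0 + f x) by ring.
apply is_lim_seq_ext with (u := fun n => (fs n (xs n) - fs n x) + fs n x);
  [intros n; ring|].
apply is_lim_seq_plus'; [exact Hz | apply Hf].
Qed.

Definition unit_frac (n : nat) : R := / (INR n + 1).

Lemma unit_frac_pos n : 0 < unit_frac n.
Proof. apply Rinv_0_lt_compat. assert (H := pos_INR n). lra. Qed.

Lemma unit_frac_lim : is_lim_seq unit_frac 0.
Proof.
replace (Finite 0) with (Rbar_inv p_infty) by reflexivity.
apply is_lim_seq_inv; [|discriminate].
apply (is_lim_seq_plus _ _ p_infty 1 p_infty);
  [apply is_lim_seq_INR | apply is_lim_seq_const | reflexivity].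
Qed.

(** Otherwise a bad point could be chosen in [D] at every distance $1/(n+1)$ from [x].
    The set [D] is there for difference quotients, whose increment must not be zero. *)
Lemma limit_by_sequences (D : R -> Prop) (F : R -> R) (x l : R) :
  (forall u, (forall n, D (u n)) -> is_lim_seq u x -> is_lim_seq (fun n => F (u n)) l) ->
  forall eps, 0 < eps ->
  exists del, 0 < del /\ forall y, D y -> Rabs (y - x) < del -> Rabs (F y - l) < eps.
Proof.
intros H eps He. apply NNPP. intros Hno.
assert (Hn : forall n : nat, exists y, D y /\ Rabs (y - x) < unit_frac n /\ eps <= Rabs (F y - l)).
{ intros n. apply NNPP. intros Hn. apply Hno.
  exists (unit_frac n). split; [apply unit_frac_pos|].
  intros y HD Hy. apply Rnot_le_lt. intros Hle. apply Hn. exists y. tauto. }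
set (u := fun n => proj1_sig (constructive_indefinite_description _ (Hn n))).
assert (Hu : forall n, D (u n) /\ Rabs (u n - x) < unit_frac n /\ eps <= Rabs (F (u n) - l)).
{ intros n. exact (proj2_sig (constructive_indefinite_description _ (Hn n))). }
assert (Hl : is_lim_seq u x).
{ apply is_lim_seq_eps. intros e Hepos.
  generalize (proj2 (is_lim_seq_eps _ _) unit_frac_lim e Hepos). apply filter_imp. intros n Hn'.
  destruct (Hu n) as [_ [H1 _]].
  assert (H2 := Rle_abs (unit_frac n - 0)). lra. }
specialize (H u (fun n => proj1 (Hu n)) Hl).
apply is_lim_seq_eps with (eps := eps) in H; [|exact He].
destruct H as [N HN]. specialize (HN N (le_n N)).
destruct (Hu N) as [_ [_ H2]]. lra.
Qed.

Lemma continuous_eps (F : R -> R) (x : R) :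
  (forall eps, 0 < eps ->
     exists del, 0 < del /\ forall y, Rabs (y - x) < del -> Rabs (F y - F x) < eps) <->
  continuous F x.
Proof.
split.
- intros H. apply filterlim_locally. intros eps.
  destruct (H eps (cond_pos eps)) as [d [Hd Hy]].
  exists (mkposreal d Hd). intros y Hb. exact (Hy y Hb).
- intros H eps He.
  apply filterlim_locally with (eps := mkposreal eps He) in H.
  destruct H as [d Hd]. exists d. split; [apply cond_pos|]. intros y Hy. exact (Hd y Hy).
Qed.

Lemma continuous_by_sequences (F : R -> R) (x : R) :
  (forall u, is_lim_seq u x -> is_lim_seq (fun n => F (u n)) (F x)) -> continuous F x.
Proof.
intros H. apply continuous_eps. intros eps He.
destruct (limit_by_sequences (fun _ => True) F x (F x)) with (eps := eps) as [d [Hd Hy]];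
  [intros u _; apply H | exact He|].
exists d. split; [exact Hd|]. intros y. exact (Hy y I).
Qed.

Lemma convex_continuous (f : R -> R) (x : R) : convex_fun f -> continuous f x.
Proof.
intros Hf. apply continuous_by_sequences. intros u Hu.
apply (convex_lim_seq (fun _ => f) f); [intros _; exact Hf | intros y; apply is_lim_seq_const | exact Hu].
Qed.

(** Recovery sequences on both sides of [x] bound the limit superior from above, because
    the values at [x] lie below those at one of the two ends; the liminf condition along the
    constant sequence bounds the limit inferior. *)
Lemma epi_converges_pointwise (fs : nat -> Conv) (f : Conv) :
  epi_converges fs f <-> forall x, is_lim_seq (fun n => fs n x) (f x).
Proof.
split.
- intros H x. apply is_lim_seq_eps. intros eps He.
  assert (Hup : eventually (fun n => fs n x < f x + eps)).
  { destruct (proj2 (continuous_eps f x) (convex_continuous f x (conv_fun_convex f))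
      (eps / 2) ltac:(lra)) as [d [Hd Hc]].
    destruct (proj2 (H (x - d / 2))) as [us [Hu Hfu]].
    destruct (proj2 (H (x + d / 2))) as [vs [Hv Hfv]].
    assert (Cu := Hc (x - d / 2) ltac:(apply Rabs_def1; lra)).
    assert (Cv := Hc (x + d / 2) ltac:(apply Rabs_def1; lra)).
    apply is_lim_seq_eps with (eps := d / 2) in Hu; [|lra].
    apply is_lim_seq_eps with (eps := d / 2) in Hv; [|lra].
    apply is_lim_seq_eps with (eps := eps / 2) in Hfu; [|lra].
    apply is_lim_seq_eps with (eps := eps / 2) in Hfv; [|lra].
    generalize (filter_and _ _ (filter_and _ _ Hu Hv) (filter_and _ _ Hfu Hfv)).
    apply filter_imp. intros n [[H1 H2] [H3 H4]].
    apply Rabs_def2 in H1. apply Rabs_def2 in H2. apply Rabs_def2 in H3.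
    apply Rabs_def2 in H4. apply Rabs_def2 in Cu. apply Rabs_def2 in Cv.
    assert (H5 := convex3 (fs n) (us n) x (vs n) (conv_fun_convex _) ltac:(lra)).
    nra. }
  assert (Hlo : eventually (fun n => f x - eps < fs n x)).
  { assert (Hi := proj1 (H x) (fun _ => x) (is_lim_seq_const x)).
    destruct (ex_LimInf_seq (fun n => fs n x)) as [l Hs].
    change (Rbar_le (f x) (LimInf_seq (fun n => conv_fun (fs n) x))) in Hi.
    rewrite (is_LimInf_seq_unique _ _ Hs) in Hi.
    destruct l as [l| |].
    - simpl in Hi. destruct (Hs (mkposreal eps He)) as [_ [N HN]].
      exists N. intros n Hn. specialize (HN n Hn). simpl in HN. lra.
    - destruct (Hs (f x - eps)) as [N HN]. exists N. exact HN.
    - destruct Hi. }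
  generalize (filter_and _ _ Hup Hlo). apply filter_imp. intros n [H1 H2].
  apply Rabs_def1; lra.
- intros H x.
  assert (Hseq : forall xs, is_lim_seq xs x -> is_lim_seq (fun n => fs n (xs n)) (f x)).
  { intros xs Hx. apply (convex_lim_seq (fun n => conv_fun (fs n)) f);
      [intros n; apply conv_fun_convex | exact H | exact Hx]. }
  split.
  + intros xs Hx.
    rewrite (is_LimInf_seq_unique _ (f x)); [apply Rbar_le_refl|].
    apply is_lim_LimInf_seq. apply Hseq. exact Hx.
  + exists (fun _ => x). split; [apply is_lim_seq_const|]. apply Hseq, is_lim_seq_const.
Qed.

(** The sets of functions whose value at a given point lies in a given open
    interval are open, so the topology is fine enough to test pointwise limits,
    and pointwise limits of convex functions are epi-limits. Everything below
    therefore deals with pointwise convergence only. *)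
Lemma epi_continuous_pointwise (Psi : Conv -> Conv) :
  epi_continuous Psi <->
  forall (fs : nat -> Conv) (f : Conv),
    (forall x, is_lim_seq (fun n => fs n x) (f x)) ->
    forall x, is_lim_seq (fun n => Psi (fs n) x) (Psi f x).
Proof.
split.
- intros H fs f Hf x. apply is_lim_seq_eps. intros eps He.
  assert (HU : epi_open (fun g => Rabs (g x - Psi f x) < eps)).
  { intros gs g Hg Hgs. rewrite epi_converges_pointwise in Hgs.
    specialize (Hgs x).
    apply is_lim_seq_eps with (eps := eps - Rabs (g x - Psi f x)) in Hgs; [|lra].
    revert Hgs. apply filter_imp. intros n Hn.
    replace (gs n x - Psi f x) with ((gs n x - g x) + (g x - Psi f x)) by ring.
    eapply Rle_lt_trans; [apply Rabs_triang|]. lra. }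
  apply (H _ HU fs f).
  + unfold Rminus. rewrite Rplus_opp_r, Rabs_R0. exact He.
  + apply epi_converges_pointwise. exact Hf.
- intros H U HU fs f Hf Hfs. apply (HU _ _ Hf).
  apply epi_converges_pointwise. apply H.
  apply epi_converges_pointwise. exact Hfs.
Qed.

(** * Smooth cutoff functions and ramps *)

Definition smooth (f : R -> R) : Prop := forall n x, ex_derive_n f n x.

Lemma Derive_n_shift (f f' : R -> R) (n : nat) :
  (forall x, is_derive f x (f' x)) -> forall x, Derive_n f (S n) x = Derive_n f' n x.
Proof.
intros H x. replace (S n) with (n + 1)%nat by lia.
rewrite <- Derive_n_comp. f_equal.
apply functional_extensionality. intros y. apply is_derive_unique, H.
Qed.

(** Smoothness is always checked through a class that is stable under differentiation, so
    that formulas for higher derivatives are never needed. *)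
Lemma smooth_of_class (P : (R -> R) -> Prop) :
  (forall f, P f -> exists f', P f' /\ forall x, is_derive f x (f' x)) ->
  forall f, P f -> smooth f.
Proof.
intros H f Hf n. revert f Hf.
induction n as [|n IH]; intros f Hf x; [exact I|].
destruct (H f Hf) as [f' [Hf' Hd]].
destruct n as [|n].
- exists (f' x). apply Hd.
- simpl. apply (ex_derive_ext (Derive_n f' n)).
  + intros y. symmetry. exact (Derive_n_shift f f' n Hd y).
  + apply (IH f' Hf' x).
Qed.

Lemma smooth_intro (f f' : R -> R) :
  (forall x, is_derive f x (f' x)) -> smooth f' -> smooth f.
Proof.
intros Hd Hf.
apply (smooth_of_class (fun g => g = f \/ exists n, g = Derive_n f' n)); [|left; reflexivity].
intros g [->|[n ->]].
- exists f'. split; [right; exists 0%nat; reflexivity | exact Hd].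
- exists (Derive_n f' (S n)). split; [right; exists (S n); reflexivity|].
  intros x. apply Derive_correct. exact (Hf (S n) x).
Qed.

Inductive algebra_of (B : (R -> R) -> Prop) : (R -> R) -> Prop :=
| alg_base f : B f -> algebra_of B f
| alg_const c : algebra_of B (fun _ => c)
| alg_plus f g : algebra_of B f -> algebra_of B g -> algebra_of B (fun x => f x + g x)
| alg_mult f g : algebra_of B f -> algebra_of B g -> algebra_of B (fun x => f x * g x).

(** The Leibniz rule keeps the derivatives of products inside the algebra. *)
Lemma smooth_algebra (B : (R -> R) -> Prop) :
  (forall f, B f -> exists f', algebra_of B f' /\ forall x, is_derive f x (f' x)) ->
  forall f, algebra_of B f -> smooth f.
Proof.
intros HB. apply smooth_of_class. intros f Hf.
induction Hf as [f Hf|c|f g Hf [f' [IHf Df]] Hg [g' [IHg Dg]]|f g Hf [f' [IHf Df]] Hg [g' [IHg Dg]]].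
- apply HB, Hf.
- exists (fun _ => 0). split; [apply alg_const|]. intros x.
  apply (is_derive_const c x).
- exists (fun x => f' x + g' x). split; [apply alg_plus; assumption|].
  intros x. apply (is_derive_plus f g x); auto.
- exists (fun x => f' x * g x + f x * g' x).
  split; [apply alg_plus; apply alg_mult; assumption|].
  intros x. apply (is_derive_mult f g x); auto. intros; apply Rmult_comm.
Qed.

Lemma smooth_binary (f g h : R -> R) :
  smooth f -> smooth g ->
  algebra_of (fun u => exists n, u = Derive_n f n \/ u = Derive_n g n) h -> smooth h.
Proof.
intros Hf Hg. apply smooth_algebra. intros u [n [->| ->]].
- exists (Derive_n f (S n)).
  split; [apply alg_base; exists (S n); left; reflexivity|].
  intros x. apply Derive_correct. exact (Hf (S n) x).
- exists (Derive_n g (S n)).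
  split; [apply alg_base; exists (S n); right; reflexivity|].
  intros x. apply Derive_correct. exact (Hg (S n) x).
Qed.

Lemma smooth_plus (f g : R -> R) : smooth f -> smooth g -> smooth (fun x => f x + g x).
Proof.
intros Hf Hg. apply (smooth_binary f g); auto.
apply alg_plus; apply alg_base; exists 0%nat; auto.
Qed.

Lemma smooth_mult (f g : R -> R) : smooth f -> smooth g -> smooth (fun x => f x * g x).
Proof.
intros Hf Hg. apply (smooth_binary f g); auto.
apply alg_mult; apply alg_base; exists 0%nat; auto.
Qed.

Lemma smooth_const (c : R) : smooth (fun _ => c).
Proof. intros n x. apply ex_derive_n_const. Qed.

Lemma smooth_scal (c : R) (f : R -> R) : smooth f -> smooth (fun x => c * f x).
Proof. intros Hf. apply (smooth_mult (fun _ => c)); [apply smooth_const | exact Hf]. Qed.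

Lemma is_derive_affine_comp (f : R -> R) (a b x l : R) :
  is_derive f (a * x + b) l -> is_derive (fun y => f (a * y + b)) x (a * l).
Proof.
intros H. apply (is_derive_comp f (fun y => a * y + b)); [exact H|].
auto_derive; [exact I | ring].
Qed.

Lemma smooth_affine_comp (f : R -> R) (a b : R) :
  smooth f -> smooth (fun y => f (a * y + b)).
Proof.
intros Hf.
apply (smooth_algebra (fun u => exists n, u = fun y => Derive_n f n (a * y + b)));
  [|apply alg_base; exists 0%nat; reflexivity].
intros u [n ->].
exists (fun y => a * Derive_n f (S n) (a * y + b)). split.
- apply (alg_mult _ (fun _ => a)); [apply alg_const | apply alg_base; exists (S n); reflexivity].
- intros x. apply (is_derive_affine_comp (Derive_n f n)).
  apply Derive_correct. exact (Hf (S n) _).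
Qed.

(** The powers of $1/x$ make the family of these functions, up to linear combinations,
    stable under differentiation. *)
Definition flat (n : nat) (x : R) : R :=
  if Rlt_dec 0 x then exp (- / x) * (/ x) ^ n else 0.

Lemma flat_pos n x : 0 < x -> 0 < flat n x.
Proof.
intros Hx. unfold flat. destruct (Rlt_dec 0 x); [|lra].
apply Rmult_lt_0_compat; [apply exp_pos | apply pow_lt, Rinv_0_lt_compat, Hx].
Qed.

Lemma flat_neg n x : x <= 0 -> flat n x = 0.
Proof. intros Hx. unfold flat. destruct (Rlt_dec 0 x); lra. Qed.

(** $e^{t}\ge t^m/m!$ with $t=1/x$ and $m=n+2$. *)
Lemma flat_small n x : 0 < x -> flat n x <= INR (fact (n + 2)) * x ^ 2.
Proof.
intros Hx. unfold flat. destruct (Rlt_dec 0 x); [|lra].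
assert (Ht : 0 < / x) by (apply Rinv_0_lt_compat; lra).
set (t := / x) in *.
assert (Hxt : x = / t) by (unfold t; rewrite Rinv_inv; reflexivity).
assert (Hf : 0 < INR (fact (n + 2))) by (apply INR_fact_lt_0).
assert (He : t ^ (n + 2) / INR (fact (n + 2)) <= exp t).
{ eapply Rle_trans; [|apply (exp_ge_taylor t (n + 2)); lra].
  replace (n + 2)%nat with (S (S n)) by lia.
  rewrite tech5.
  assert (0 <= sum_f_R0 (fun k => t ^ k / INR (fact k)) (S n)); [|lra].
  apply cond_pos_sum. intros k.
  apply Rmult_le_pos; [apply pow_le; lra | left; apply Rinv_0_lt_compat, INR_fact_lt_0]. }
rewrite exp_Ropp. rewrite Hxt.
apply (Rmult_le_reg_l (exp t)); [apply exp_pos|].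
replace (exp t * (/ exp t * t ^ n)) with (t ^ n) by (field; apply Rgt_not_eq, exp_pos).
assert (Hp : 0 < (/ t) ^ 2) by (apply pow_lt, Rinv_0_lt_compat; lra).
apply Rmult_le_compat_l with (r := INR (fact (n + 2)) * (/ t) ^ 2) in He; [|nra].
eapply Rle_trans; [|right; instantiate (1 := INR (fact (n + 2)) * (/ t) ^ 2 * exp t); ring].
eapply Rle_trans; [|exact He].
right. rewrite pow_add. field. split; [lra|]. apply Rgt_not_eq; lra.
Qed.

Lemma flat_derive n x :
  is_derive (flat n) x (flat (n + 2) x - INR n * flat (n + 1) x).
Proof.
destruct (Rtotal_order x 0) as [Hx|[->|Hx]].
- rewrite !flat_neg by lra. replace (0 - INR n * 0) with 0 by ring.
  apply (is_derive_ext_loc (fun _ => 0)); [|apply (is_derive_const 0 x)].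
  exists (mkposreal (- x) ltac:(lra)). intros y Hy.
  change (Rabs (y - x) < - x) in Hy. apply Rabs_def2 in Hy. rewrite flat_neg; lra.
- rewrite !flat_neg by lra. replace (0 - INR n * 0) with 0 by ring.
  apply is_derive_Reals. intros eps He.
  assert (Hf : 0 < INR (fact (n + 2))) by (apply INR_fact_lt_0).
  set (C := INR (fact (n + 2))) in *.
  exists (mkposreal (eps / C) (Rdiv_lt_0_compat _ _ He Hf)).
  intros h Hh0 Hh. simpl in Hh.
  rewrite Rplus_0_l, (flat_neg n 0), !Rminus_0_r by lra.
  destruct (Rlt_dec 0 h) as [Hp|Hn].
  + assert (H1 := flat_small n h Hp). fold C in H1.
    assert (H2 := flat_pos n h Hp).
    rewrite Rabs_pos_eq in * by (try apply Rlt_le, Rdiv_lt_0_compat; lra).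
    apply (Rmult_lt_reg_r h); [lra|]. unfold Rdiv at 1. rewrite Rmult_assoc, Rinv_l, Rmult_1_r by lra.
    assert (h * C < eps).
    { apply (Rmult_lt_compat_r C) in Hh; [|lra]. unfold Rdiv in Hh.
      rewrite Rmult_assoc, Rinv_l, Rmult_1_r in Hh by lra. exact Hh. }
    simpl in H1. nra.
  + rewrite flat_neg by lra. unfold Rdiv. rewrite Rmult_0_l, Rabs_R0. exact He.
- apply (is_derive_ext_loc (fun y => exp (- / y) * (/ y) ^ n)).
  { exists (mkposreal x Hx). intros y Hy.
    change (Rabs (y - x) < x) in Hy. apply Rabs_def2 in Hy.
    unfold flat. destruct (Rlt_dec 0 y); lra. }
  unfold flat. destruct (Rlt_dec 0 x); [|lra].
  auto_derive; [lra|].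
  destruct n as [|n].
  + simpl. field. lra.
  + rewrite !pow_add. simpl. 
    replace (match n with 0%nat => 1 | S _ => INR n + 1 end) with (INR n + 1)
      by (destruct n; simpl; lra).
    assert ((/ x) ^ n = / x ^ n) by (apply pow_inv). field. lra.
Qed.

Lemma flat_smooth n : smooth (flat n).
Proof.
apply (smooth_algebra (fun u => exists n, u = flat n)); [|apply alg_base; exists n; reflexivity].
intros u [k ->]. exists (fun x => flat (k + 2) x + (- INR k) * flat (k + 1) x). split.
- apply alg_plus; [apply alg_base; eauto|].
  apply (alg_mult _ (fun _ => - INR k)); [apply alg_const | apply alg_base; eauto].
- intros x. replace (flat (k + 2) x + - INR k * flat (k + 1) x)
    with (flat (k + 2) x - INR k * flat (k + 1) x) by ring. apply flat_derive.
Qed.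

Lemma ex_derive_continuous_R (f : R -> R) (x : R) : ex_derive f x -> continuous f x.
Proof. apply (ex_derive_continuous (V := R_NormedModule)). Qed.

Lemma smooth_continuous (f : R -> R) (x : R) : smooth f -> continuous f x.
Proof. intros H. apply ex_derive_continuous_R, (H 1%nat x). Qed.

Lemma ex_RInt_cont (f : R -> R) (a b : R) :
  (forall x, continuous f x) -> ex_RInt f a b.
Proof. intros H. apply (ex_RInt_continuous (V := R_CompleteNormedModule)). intros z _. apply H. Qed.

Lemma is_derive_primitive (f : R -> R) (a x : R) :
  (forall y, continuous f y) -> is_derive (fun y => RInt f a y) x (f x).
Proof.
intros H. apply (is_derive_RInt f (fun y => RInt f a y) a x); [|apply H].
apply filter_forall. intros y.
apply (RInt_correct (V := R_CompleteNormedModule)), ex_RInt_cont, H.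
Qed.

Definition bump (t : R) : R := flat 0 t * flat 0 (-1 * t + 1).
Definition step (t : R) : R := RInt bump 0 t / RInt bump 0 1.

(** A smooth version of $\max(t,0)$ with its curvature spread over $[0,1]$; for $t\ge1$ it
    is $t$ plus a constant, which second differences do not see. *)
Definition ramp (t : R) : R := RInt step 0 t.

Lemma bump_smooth : smooth bump.
Proof.
unfold bump. apply smooth_mult; [apply flat_smooth|].
apply (smooth_affine_comp (flat 0)), flat_smooth.
Qed.

Lemma bump_nonneg t : 0 <= bump t.
Proof.
unfold bump.
assert (H : forall s, 0 <= flat 0 s).
{ intros s. destruct (Rlt_dec 0 s); [left; apply flat_pos; lra | rewrite flat_neg; lra]. }
apply Rmult_le_pos; apply H.
Qed.

Lemma bump_out t : t <= 0 \/ 1 <= t -> bump t = 0.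
Proof.
unfold bump. intros [H|H]; [rewrite (flat_neg 0 t H) | rewrite (flat_neg 0 (-1 * t + 1)) by lra]; ring.
Qed.

Lemma bump_mass : 0 < RInt bump 0 1.
Proof.
apply RInt_gt_0; [lra| |].
- intros x Hx. unfold bump. apply Rmult_lt_0_compat; apply flat_pos; lra.
- intros x _. apply smooth_continuous, bump_smooth.
Qed.

Lemma RInt_zero (f : R -> R) (a b : R) :
  (forall x, Rmin a b < x < Rmax a b -> f x = 0) -> RInt f a b = 0.
Proof.
intros H. rewrite (RInt_ext f (fun _ => 0)) by exact H.
rewrite RInt_const. unfold scal; simpl; unfold mult; simpl. ring.
Qed.

Lemma RInt_split (f : R -> R) (a b c : R) :
  (forall x, continuous f x) -> RInt f a c = RInt f a b + RInt f b c.
Proof.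
intros H. symmetry. apply (RInt_Chasles f a b c); apply ex_RInt_cont, H.
Qed.

Lemma step_left t : t <= 0 -> step t = 0.
Proof.
intros Ht. unfold step. rewrite RInt_zero; [unfold Rdiv; ring|].
intros x Hx. rewrite Rmax_left in Hx by lra. apply bump_out. lra.
Qed.

Lemma step_right t : 1 <= t -> step t = 1.
Proof.
intros Ht. unfold step.
rewrite (RInt_split bump 0 1 t) by (intros x; apply smooth_continuous, bump_smooth).
rewrite (RInt_zero bump 1 t).
- assert (H := bump_mass). field. lra.
- intros x Hx. rewrite Rmin_left in Hx by lra. apply bump_out. lra.
Qed.

Lemma step_derive t : is_derive step t (bump t / RInt bump 0 1).
Proof.
unfold step. apply (is_derive_ext (fun s => / RInt bump 0 1 * RInt bump 0 s)).
{ intros s. unfold Rdiv. apply Rmult_comm. }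
replace (bump t / RInt bump 0 1) with (/ RInt bump 0 1 * bump t) by (unfold Rdiv; ring).
apply is_derive_scal. apply is_derive_primitive.
intros y. apply smooth_continuous, bump_smooth.
Qed.

Lemma step_smooth : smooth step.
Proof.
apply (smooth_intro _ _ step_derive).
apply (smooth_mult bump (fun _ => / RInt bump 0 1)); [apply bump_smooth | apply smooth_const].
Qed.

Lemma step_nonneg t : 0 <= step t.
Proof.
destruct (Rle_dec t 0) as [H|H]; [rewrite step_left; lra|].
unfold step. apply Rmult_le_pos; [|left; apply Rinv_0_lt_compat, bump_mass].
apply RInt_ge_0; [lra | |intros x _; apply bump_nonneg].
apply ex_RInt_cont. intros x. apply smooth_continuous, bump_smooth.
Qed.

Lemma ramp_derive t : is_derive ramp t (step t).
Proof. apply is_derive_primitive. intros y. apply smooth_continuous, step_smooth. Qed.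

Lemma ramp_smooth : smooth ramp.
Proof. exact (smooth_intro _ _ ramp_derive step_smooth). Qed.

Lemma ramp_left t : t <= 0 -> ramp t = 0.
Proof.
intros Ht. unfold ramp. apply RInt_zero.
intros x Hx. rewrite Rmax_left in Hx by lra. apply step_left. lra.
Qed.

Lemma ramp_right t : 1 <= t -> ramp t = t + (ramp 1 - 1).
Proof.
intros Ht. unfold ramp.
rewrite (RInt_split step 0 1 t) by (intros x; apply smooth_continuous, step_smooth).
rewrite (RInt_ext step (fun _ => 1) 1 t).
- rewrite RInt_const. unfold scal; simpl; unfold mult; simpl. ring.
- intros x Hx. rewrite Rmin_left in Hx by lra. apply step_right. lra.
Qed.

Lemma adherence_mono (D E : R -> Prop) : included D E -> closed_set E -> included (adherence D) E.
Proof.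
intros H HE x Hx. apply (adherence_P2 E HE).
intros V HV. destruct (Hx V HV) as [y [H1 H2]]. exists y. split; [exact H1 | apply H, H2].
Qed.

Lemma closed_segment a b : closed_set (fun x => a <= x <= b).
Proof. apply compact_P2, compact_P3. Qed.

Lemma supp_in_segment (phi : R -> R) (a b : R) :
  (forall y, y < a \/ b < y -> phi y = 0) -> included (fun_supp phi) (fun y => a <= y <= b).
Proof.
intros H. apply adherence_mono; [|apply closed_segment].
intros y Hy. destruct (Rlt_dec y a); [exfalso; auto|]. destruct (Rlt_dec b y); [exfalso; auto|]. lra.
Qed.

Lemma test_fun_segment (phi : R -> R) (a b : R) :
  smooth phi -> (forall y, y < a \/ b < y -> phi y = 0) -> test_fun phi.
Proof.
intros Hs H. split; [exact Hs|].
apply (compact_P4 (fun x => a <= x <= b)); [apply compact_P3 | apply adherence_P3 |].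
apply supp_in_segment, H.
Qed.

Lemma supp_incl (phi : R -> R) (y : R) : phi y <> 0 -> fun_supp phi y.
Proof. intros H. apply (adherence_P1 (fun y => phi y <> 0) y H). Qed.

Lemma test_fun_bounded (phi : R -> R) :
  test_fun phi -> exists L, 0 < L /\ forall y, y < - L \/ L < y -> phi y = 0.
Proof.
intros [_ Hc]. destruct (compact_P1 _ Hc) as [m [M H]].
exists (Rabs m + Rabs M + 1).
assert (H1 := Rle_abs M). assert (H2 := Rle_abs (- m)). rewrite Rabs_Ropp in H2.
assert (H3 := Rabs_pos M). assert (H4 := Rabs_pos m).
split; [lra|]. intros y Hy.
apply NNPP. intros Hne. specialize (H y (supp_incl phi y Hne)). lra.
Qed.

Definition plateau (r y : R) : R := step (1 * y + (r + 2)) * step (-1 * y + (r + 2)).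

Lemma plateau_smooth r : smooth (plateau r).
Proof.
apply (smooth_mult (fun y => step (1 * y + (r + 2))) (fun y => step (-1 * y + (r + 2))));
  apply (smooth_affine_comp step), step_smooth.
Qed.

Lemma plateau_out r y : y < - (r + 2) \/ r + 2 < y -> plateau r y = 0.
Proof.
intros [H|H]; unfold plateau;
  [rewrite (step_left (1 * y + (r + 2))) by lra | rewrite (step_left (-1 * y + (r + 2))) by lra]; ring.
Qed.

Lemma plateau_one r y : - (r + 1) <= y <= r + 1 -> plateau r y = 1.
Proof. intros H. unfold plateau. rewrite !step_right by lra. ring. Qed.

Lemma plateau_test r : test_fun (plateau r).
Proof.
apply (test_fun_segment _ (- (r + 2)) (r + 2)); [apply plateau_smooth|].
intros y. apply plateau_out.
Qed.

Lemma open_interval a b : open_set (fun y => a < y < b).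
Proof.
intros y Hy. 
assert (Hd : 0 < Rmin (y - a) (b - y)) by (apply Rmin_pos; lra).
exists (mkposreal _ Hd). intros z Hz. unfold disc in Hz. simpl in Hz.
apply Rabs_def2 in Hz. assert (H1 := Rmin_l (y - a) (b - y)). assert (H2 := Rmin_r (y - a) (b - y)). lra.
Qed.

Lemma plateau_cutoff (K : R -> Prop) r :
  (forall y, K y -> - r <= y <= r) -> cutoff K (plateau r).
Proof.
intros HK. split; [apply plateau_test|].
exists (fun y => - (r + 1) < y < r + 1). split; [apply open_interval|]. split.
- intros y Hy. apply HK in Hy. lra.
- intros y Hy. apply plateau_one. lra.
Qed.

Lemma plateau_nonneg r y : 0 <= plateau r y.
Proof. apply Rmult_le_pos; apply step_nonneg. Qed.

(** * Twice differentiable functions, integration by parts and local affinity *)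

(** An equality between reals may be typed in the carrier of some structure on [R], where
    [ring] and [field] do not recognise the operations. *)
Ltac Rring := match goal with |- @eq _ ?a ?b => change (@eq R a b) end; ring.

Ltac Rfield := match goal with |- @eq _ ?a ?b => change (@eq R a b) end; field.

Lemma continuous_mult_R (f g : R -> R) x :
  continuous f x -> continuous g x -> continuous (fun y => f y * g y) x.
Proof. apply (continuous_mult f g). Qed.

Lemma continuous_plus_R (f g : R -> R) x :
  continuous f x -> continuous g x -> continuous (fun y => f y + g y) x.
Proof. apply (continuous_plus f g). Qed.

Lemma continuous_minus_R (f g : R -> R) x :
  continuous f x -> continuous g x -> continuous (fun y => f y - g y) x.
Proof. apply (continuous_minus f g). Qed.

(** Carrying the derivatives as functions avoids rewriting with [Derive_n]. *)
Record twice (u u1 u2 : R -> R) : Prop := {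
  twice_1 : forall y, is_derive u y (u1 y);
  twice_2 : forall y, is_derive u1 y (u2 y);
  twice_cont : forall y, continuous u2 y
}.

Lemma twice_C2 u u1 u2 : twice u u1 u2 -> C2 u.
Proof.
intros [H1 H2 H3].
assert (E : Derive u = u1).
{ apply functional_extensionality. intros y. apply is_derive_unique, H1. }
split; [|split].
- intros x. exists (u1 x). apply H1.
- intros x. simpl. change (ex_derive (Derive u) x). rewrite E. exists (u2 x). apply H2.
- intros x. apply (continuous_ext u2); [|apply H3].
  intros y. simpl. change (u2 y = Derive (Derive u) y). rewrite E.
  symmetry. apply is_derive_unique, H2.
Qed.

Lemma C2_twice u : C2 u -> twice u (Derive u) (Derive_n u 2).
Proof.
intros [H1 [H2 H3]]. split; [| |exact H3].
- intros y. apply Derive_correct, H1.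
- intros y. exact (Derive_correct (Derive u) y (H2 y)).
Qed.

Lemma twice_Derive_n u u1 u2 : twice u u1 u2 -> Derive_n u 2 = u2.
Proof.
intros [H1 H2 _]. apply functional_extensionality. intros y.
rewrite (Derive_n_shift u u1 1 H1). apply is_derive_unique, H2.
Qed.

Lemma smooth_twice u : smooth u -> twice u (Derive u) (Derive_n u 2).
Proof.
intros H. apply C2_twice. split; [|split].
- intros x. exact (H 1%nat x).
- intros x. exact (H 2%nat x).
- intros x. apply ex_derive_continuous_R. exact (H 3%nat x).
Qed.

Lemma twice_continuous u u1 u2 y : twice u u1 u2 -> continuous u y.
Proof. intros H. apply ex_derive_continuous_R. exists (u1 y). apply H. Qed.

Lemma twice_continuous1 u u1 u2 y : twice u u1 u2 -> continuous u1 y.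
Proof. intros H. apply ex_derive_continuous_R. exists (u2 y). apply H. Qed.

Lemma twice_lin u u1 u2 v v1 v2 (c d : R) : twice u u1 u2 -> twice v v1 v2 ->
  twice (fun y => c * u y + d * v y) (fun y => c * u1 y + d * v1 y) (fun y => c * u2 y + d * v2 y).
Proof.
intros [A1 A2 A3] [B1 B2 B3]. split; intros y.
- apply (is_derive_plus (fun y => c * u y) (fun y => d * v y)); apply is_derive_scal; auto.
- apply (is_derive_plus (fun y => c * u1 y) (fun y => d * v1 y)); apply is_derive_scal; auto.
- apply continuous_plus_R; apply continuous_mult_R; try apply continuous_const; auto.
Qed.

Lemma twice_mult u u1 u2 v v1 v2 : twice u u1 u2 -> twice v v1 v2 ->
  twice (fun y => u y * v y) (fun y => u1 y * v y + u y * v1 y)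
    (fun y => u2 y * v y + u1 y * v1 y + (u1 y * v1 y + u y * v2 y)).
Proof.
intros Hu Hv. destruct Hu as [A1 A2 A3] eqn:Eu. destruct Hv as [B1 B2 B3] eqn:Ev.
split; intros y.
- apply (is_derive_mult u v); auto. intros; apply Rmult_comm.
- apply (is_derive_plus (fun y => u1 y * v y) (fun y => u y * v1 y));
    [apply (is_derive_mult u1 v) | apply (is_derive_mult u v1)]; auto; intros; apply Rmult_comm.
- assert (Cu := twice_continuous _ _ _ y Hu). assert (Cv := twice_continuous _ _ _ y Hv).
  assert (Cu1 := twice_continuous1 _ _ _ y Hu). assert (Cv1 := twice_continuous1 _ _ _ y Hv).
  repeat (apply continuous_plus_R || apply continuous_mult_R); auto.
Qed.

Lemma twice_const c : twice (fun _ => c) (fun _ => 0) (fun _ => 0).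
Proof.
split; intros y; try apply continuous_const; apply (is_derive_const (V := R_NormedModule)).
Qed.

Lemma twice_id : twice (fun y => y) (fun _ => 1) (fun _ => 0).
Proof.
split; intros y; [apply (is_derive_id (K := R_AbsRing)) | | apply continuous_const];
  apply (is_derive_const (V := R_NormedModule)).
Qed.

Lemma twice_affine_comp u u1 u2 a b : twice u u1 u2 ->
  twice (fun y => u (a * y + b)) (fun y => a * u1 (a * y + b)) (fun y => a * (a * u2 (a * y + b))).
Proof.
intros [A1 A2 A3]. split; intros y.
- apply (is_derive_affine_comp u), A1.
- apply is_derive_scal, (is_derive_affine_comp u1), A2.
- apply continuous_mult_R; [apply continuous_const|].
  apply continuous_mult_R; [apply continuous_const|].
  apply (continuous_comp (fun y => a * y + b) u2); [|apply A3].
  apply ex_derive_continuous_R. auto_derive. exact I.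
Qed.

Lemma mean_value f f' a b : (forall x, is_derive f x (f' x)) -> a < b ->
  exists c, a <= c <= b /\ f b - f a = f' c * (b - a).
Proof.
intros H Hab.
destruct (MVT_gen f a b f') as [c [Hc E]].
- intros x _. apply H.
- intros x _. apply continuity_pt_filterlim. apply ex_derive_continuous_R. exists (f' x). apply H.
- rewrite Rmin_left, Rmax_right in Hc by lra. exists c. auto.
Qed.

Lemma convex_of_twice u u1 u2 : twice u u1 u2 -> (forall y, 0 <= u2 y) -> convex_fun u.
Proof.
intros [A1 A2 _] Hp. apply convex3_intro. intros a m b Hm.
destruct (mean_value u u1 a m A1) as [c [Hc E1]]; [lra|].
destruct (mean_value u u1 m b A1) as [d [Hd E2]]; [lra|].
assert (u1 c <= u1 d).
{ destruct (Req_dec c d) as [->|Hne]; [lra|].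
  destruct (mean_value u1 u2 c d A2) as [z [Hz E3]]; [lra|]. specialize (Hp z). nra. }
assert (0 <= (m - a) * (b - m) * (u1 d - u1 c)) by (apply Rmult_le_pos; nra).
replace (u b) with (u m + u1 d * (b - m)) by lra.
replace (u a) with (u m - u1 c * (m - a)) by lra.
lra.
Qed.

Lemma convex_tangent f f' x y : convex_fun f -> is_derive f x (f' x) ->
  f x + f' x * (y - x) <= f y.
Proof.
intros Hf Hd. apply Rnot_lt_le. intros Hlt.
set (e := (f x + f' x * (y - x) - f y) / (Rabs (y - x) + 1)).
assert (Hn := Rabs_pos (y - x)).
assert (He : 0 < e) by (apply Rdiv_lt_0_compat; lra).
apply is_derive_Reals in Hd. destruct (Hd e He) as [d Hd'].
assert (Hne : y - x <> 0).
{ intros E. rewrite E in Hlt. replace y with x in Hlt by lra. lra. }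
(* the slope from x towards y over a short time t is at most the slope to y *)
assert (Hd0 := cond_pos d).
set (t := Rmin 1 (d / (2 * (Rabs (y - x) + 1)))).
assert (Ht0 : 0 < t) by (apply Rmin_pos; [lra | apply Rdiv_lt_0_compat; lra]).
assert (Ht1 : t <= 1) by apply Rmin_l.
assert (Ht2 : t * (Rabs (y - x) + 1) <= d / 2).
{ apply Rle_trans with (d / (2 * (Rabs (y - x) + 1)) * (Rabs (y - x) + 1)).
  - apply Rmult_le_compat_r; [lra | apply Rmin_r].
  - right. field. lra. }
assert (Hh : t * (y - x) <> 0) by (apply Rmult_integral_contrapositive_currified; lra).
assert (Hb : Rabs (t * (y - x)) < d).
{ rewrite Rabs_mult, (Rabs_pos_eq t) by lra. nra. }
specialize (Hd' _ Hh Hb).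
assert (Hc := Hf y x t ltac:(lra)).
replace (t * y + (1 - t) * x) with (x + t * (y - x)) in Hc by ring.
assert (Ea : Rabs (f (x + t * (y - x)) - f x - f' x * (t * (y - x))) < e * (t * Rabs (y - x))).
{ replace (f (x + t * (y - x)) - f x - f' x * (t * (y - x))) with
   (((f (x + t * (y - x)) - f x) / (t * (y - x)) - f' x) * (t * (y - x))) by (field; split; lra).
  rewrite Rabs_mult. rewrite (Rabs_mult t), (Rabs_pos_eq t) by lra.
  apply Rmult_lt_compat_r; [|exact Hd'].
  apply Rmult_lt_0_compat; [lra | apply Rabs_pos_lt; lra]. }
apply Rabs_def2 in Ea.
assert (Ee : e * (Rabs (y - x) + 1) = f x + f' x * (y - x) - f y) by (unfold e; field; lra).
apply (f_equal (Rmult t)) in Ee.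
assert (0 < t * e) by (apply Rmult_lt_0_compat; lra).
nra.
Qed.

Lemma convex_twice_nonneg u u1 u2 y : convex_fun u -> twice u u1 u2 -> 0 <= u2 y.
Proof.
intros Hc [A1 A2 _]. apply Rnot_lt_le. intros Hlt.
assert (Hmono : forall z, 0 <= (u1 z - u1 y) * (z - y)).
{ intros z. assert (H1 := convex_tangent u u1 y z Hc (A1 y)).
  assert (H2 := convex_tangent u u1 z y Hc (A1 z)). nra. }
assert (Hd := A2 y). apply is_derive_Reals in Hd.
destruct (Hd (- u2 y) ltac:(lra)) as [d Hd'].
assert (Hd0 := cond_pos d).
specialize (Hd' (d / 2) ltac:(lra) ltac:(rewrite Rabs_pos_eq; lra)).
specialize (Hmono (y + d / 2)).
apply Rabs_def2 in Hd'.
assert (0 <= (u1 (y + d / 2) - u1 y) / (d / 2)); [|lra].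
apply Rmult_le_pos; [nra | left; apply Rinv_0_lt_compat; lra].
Qed.

Lemma locally_out (L y : R) : y < - L \/ L < y -> locally y (fun z => z < - L \/ L < z).
Proof.
intros [H|H].
- exists (mkposreal (- L - y) ltac:(lra)). intros z Hz.
  change (Rabs (z - y) < - L - y) in Hz. apply Rabs_def2 in Hz. lra.
- exists (mkposreal (y - L) ltac:(lra)). intros z Hz.
  change (Rabs (z - y) < y - L) in Hz. apply Rabs_def2 in Hz. lra.
Qed.

Lemma locally_zero_derive u u1 y :
  (forall z, is_derive u z (u1 z)) -> locally y (fun z => u z = 0) ->
  locally y (fun z => u1 z = 0).
Proof.
intros Hd H. apply locally_locally in H. revert H. apply filter_imp. intros z Hz.
rewrite <- (is_derive_unique u z (u1 z) (Hd z)).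
rewrite (Derive_ext_loc _ _ z Hz). apply Derive_const.
Qed.

Lemma twice_locally_zero u u1 u2 y : twice u u1 u2 -> locally y (fun z => u z = 0) ->
  u y = 0 /\ u1 y = 0 /\ u2 y = 0.
Proof.
intros [A1 A2 _] H.
assert (H1 := locally_zero_derive u u1 y A1 H).
assert (H2 := locally_zero_derive u1 u2 y A2 H1).
apply locally_singleton in H. apply locally_singleton in H1. apply locally_singleton in H2. auto.
Qed.

Lemma RInt_fundamental (F f : R -> R) a b : a <= b ->
  (forall x, a <= x <= b -> is_derive F x (f x)) -> (forall x, continuous f x) ->
  RInt f a b = F b - F a.
Proof.
intros Hab Hd Hc. apply is_RInt_unique. apply (is_RInt_derive F f).
- intros x Hx. rewrite Rmin_left, Rmax_right in Hx by lra. apply Hd, Hx.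
- intros x _. apply Hc.
Qed.

Lemma RInt_abs_le (F G : R -> R) a b : a <= b -> (forall y, continuous F y) -> (forall y, continuous G y) ->
  (forall y, a <= y <= b -> Rabs (F y) <= G y) -> Rabs (RInt F a b) <= RInt G a b.
Proof.
intros Hab HF HG H.
apply Rle_trans with (RInt (fun y => Rabs (F y)) a b).
- apply (abs_RInt_le F a b); [exact Hab | apply ex_RInt_cont, HF].
- apply RInt_le; [exact Hab | | apply ex_RInt_cont, HG | intros y Hy; apply H; lra].
  apply ex_RInt_cont. intros y. apply (continuous_comp F Rabs); [apply HF | apply continuous_Rabs].
Qed.

Lemma RInt_lin (f g : R -> R) (c d : R) a b :
  (forall x, continuous f x) -> (forall x, continuous g x) ->
  RInt (fun y => c * f y + d * g y) a b = c * RInt f a b + d * RInt g a b.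
Proof.
intros Hf Hg. apply is_RInt_unique.
apply (is_RInt_plus (fun y => c * f y) (fun y => d * g y)).
- apply (is_RInt_scal f a b c). apply (RInt_correct f), ex_RInt_cont, Hf.
- apply (is_RInt_scal g a b d). apply (RInt_correct g), ex_RInt_cont, Hg.
Qed.

(** The integrand vanishes wherever [u] does, so all large intervals give the same value. *)
Lemma dist_d2_RInt g u u1 u2 L a b :
  twice u u1 u2 -> (forall y, continuous g y) ->
  0 < L -> (forall y, y < - L \/ L < y -> u y = 0) -> a <= - L -> L <= b ->
  dist_d2 g u = RInt (fun y => u2 y * g y) a b.
Proof.
intros Hu Hg HL Hz Ha Hb. unfold dist_d2. rewrite (twice_Derive_n _ _ _ Hu).
assert (Hcont : forall y : R, continuous (fun y : R => u2 y * g y) y).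
{ intros y. apply continuous_mult_R; [apply Hu | apply Hg]. }
assert (H0 : forall y, y < - L \/ L < y -> u2 y * g y = 0).
{ intros y Hy. replace (u2 y) with 0; [ring|]. symmetry.
  apply (twice_locally_zero u u1 u2 y Hu).
  generalize (locally_out L y Hy). apply filter_imp. exact Hz. }
assert (Hsame : forall x y, x <= - L -> L <= y ->
  RInt (fun y => u2 y * g y) x y = RInt (fun y => u2 y * g y) (- L) L :> R).
{ intros x y Hx Hy.
  rewrite (RInt_split _ x (- L) y Hcont), (RInt_split _ (- L) L y Hcont).
  rewrite (RInt_zero _ x (- L)), (RInt_zero _ L y); [ring| |]; intros z Hzz; apply H0.
  - rewrite Rmin_left in Hzz by lra. lra.
  - rewrite Rmax_right in Hzz by lra. lra. }
rewrite (Hsame a b) by lra.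
apply is_RInt_gen_unique. intros P HP.
exists (fun x => x < - L) (fun y => L < y).
- exists (- L). auto.
- exists L. auto.
- intros x y Hx Hy. exists (RInt (fun y => u2 y * g y) x y). split.
  + apply (RInt_correct (fun y => u2 y * g y)), ex_RInt_cont, Hcont.
  + rewrite Hsame by lra. apply locally_singleton, HP.
Qed.

Definition loc_affine (g : R -> R) (y : R) : Prop :=
  exists c d, locally y (fun z => g z = c + d * z).

Lemma loc_affine_Derive g y c d : locally y (fun z => g z = c + d * z) ->
  locally y (fun z => Derive g z = d).
Proof.
intros H. apply locally_locally in H. revert H. apply filter_imp. intros z Hz.
rewrite (Derive_ext_loc _ _ z Hz). apply is_derive_unique.
auto_derive; [exact I | ring].
Qed.

(** Where [g] is affine, $u''g$ is the derivative of the Wronskian-like expression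
    $u'g-ug'$; where [u] vanishes both are zero, whatever [g] is. No subdivision of
    the interval is needed, because each point satisfies one of the alternatives. *)
Lemma parts_loc_affine u u1 u2 g a b :
  twice u u1 u2 -> (forall y, continuous g y) -> a <= b ->
  (forall y, a <= y <= b -> loc_affine g y \/ locally y (fun z => u z = 0)) ->
  RInt (fun y => u2 y * g y) a b =
  (u1 b * g b - u b * Derive g b) - (u1 a * g a - u a * Derive g a).
Proof.
intros Hu Hg Hab H.
apply (RInt_fundamental (fun y => u1 y * g y - u y * Derive g y)); [exact Hab| |].
- intros y Hy. destruct (H y Hy) as [[c [d Hl]]|Hl].
  + apply (is_derive_ext_loc (fun z => u1 z * (c + d * z) - u z * d)).
    { generalize (filter_and _ _ Hl (loc_affine_Derive g y c d Hl)).
      apply filter_imp. intros z [-> ->]. reflexivity. }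
    rewrite (locally_singleton _ _ Hl).
    destruct Hu as [A1 A2 _].
    replace (u2 y * (c + d * y)) with ((u2 y * (c + d * y) + u1 y * d) - u1 y * d) by ring.
    apply (is_derive_minus (fun z => u1 z * (c + d * z)) (fun z => u z * d)).
    * apply (is_derive_mult u1 (fun z => c + d * z)); [apply A2| |intros; apply Rmult_comm].
      auto_derive; [exact I | ring].
    * apply (is_derive_ext (fun z => d * u z)); [intros; apply Rmult_comm|].
      rewrite Rmult_comm. apply is_derive_scal, A1.
  + destruct (twice_locally_zero u u1 u2 y Hu Hl) as [_ [_ E2]]. rewrite E2, Rmult_0_l.
    apply (is_derive_ext_loc (fun _ => 0)); [|apply (is_derive_const (V := R_NormedModule))].
    generalize (filter_and _ _ Hl (locally_zero_derive u u1 y (twice_1 _ _ _ Hu) Hl)).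
    apply filter_imp. intros z [-> ->]. Rring.
- intros y. apply continuous_mult_R; [apply Hu | apply Hg].
Qed.

(** Integrating by parts against the constant 1 and against the identity, whose second
    derivatives vanish, shows that the slope is constant and is that of the chord. *)
Lemma loc_affine_segment g a b : (forall y, continuous g y) -> a <= b ->
  (forall y, a <= y <= b -> loc_affine g y) ->
  Derive g a = Derive g b /\ g b - g a = (b - a) * Derive g b.
Proof.
intros Hg Hab H.
assert (H1 := parts_loc_affine _ _ _ g a b (twice_const 1) Hg Hab
  (fun y Hy => or_introl (H y Hy))).
assert (H2 := parts_loc_affine _ _ _ g a b twice_id Hg Hab
  (fun y Hy => or_introl (H y Hy))).
rewrite RInt_zero in H1 by (intros; Rring). rewrite RInt_zero in H2 by (intros; Rring).
assert (E : Derive g a = Derive g b) by lra. rewrite E in H2. split; lra.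
Qed.

(** Integration by parts applies to every test function supported near [y]: at each point
    either [g] is affine or the test function vanishes. *)
Lemma loc_affine_outside_supp g y : (forall y, continuous g y) ->
  loc_affine g y -> ~ dist_supp (dist_d2 g) y.
Proof.
intros Hg [c [d [e He]]] Hs.
assert (Hpos := cond_pos e).
destruct (Hs (fun z => y - e < z < y + e) (open_interval _ _) ltac:(lra)) as [phi [Ht [Hi Hne]]].
apply Hne.
destruct (test_fun_bounded phi Ht) as [L [HL Hz]].
assert (Hphi := smooth_twice phi (proj1 Ht)).
assert (Hz' : forall z, z < - (L + 1) \/ L + 1 < z -> phi z = 0) by (intros z Hzz; apply Hz; lra).
rewrite (dist_d2_RInt g phi _ _ (L + 1) (- (L + 1)) (L + 1) Hphi Hg) by (auto; lra).
rewrite (parts_loc_affine _ _ _ g _ _ Hphi Hg).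
- assert (Hb : locally (L + 1) (fun z => phi z = 0)).
  { generalize (locally_out L (L + 1) ltac:(lra)). apply filter_imp, Hz. }
  assert (Ha : locally (- (L + 1)) (fun z => phi z = 0)).
  { generalize (locally_out L (- (L + 1)) ltac:(lra)). apply filter_imp, Hz. }
  destruct (twice_locally_zero _ _ _ _ Hphi Ha) as [-> [-> _]].
  destruct (twice_locally_zero _ _ _ _ Hphi Hb) as [-> [-> _]]. ring.
- lra.
- intros z _. destruct (classic (fun_supp phi z)) as [Hzs|Hzs].
  + left. apply Hi in Hzs. exists c, d.
    apply (locally_interval _ z (Finite (y - e)) (Finite (y + e))); simpl; try lra.
    intros w H1 H2. apply He. change (Rabs (w - y) < e). apply Rabs_def1; lra.
  + right. apply NNPP. intros Hno. apply Hzs. intros V [delta HV].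
    apply NNPP. intros Hn. apply Hno. exists delta. intros w Hw.
    apply NNPP. intros Hw0. apply Hn. exists w. split; [apply HV, Hw | exact Hw0].
Qed.

Definition kernel (t : R) : R := bump t / RInt bump 0 1.

Lemma ramp_twice : twice ramp step kernel.
Proof.
split; [exact ramp_derive | exact step_derive|].
intros y. apply (continuous_mult_R bump (fun _ => / RInt bump 0 1)); [|apply continuous_const].
apply smooth_continuous, bump_smooth.
Qed.

Lemma kernel_nonneg t : 0 <= kernel t.
Proof.
apply Rmult_le_pos; [apply bump_nonneg | left; apply Rinv_0_lt_compat, bump_mass].
Qed.

Definition ramp_at (a e y : R) : R := e * ramp (/ e * y + - a / e).

Lemma ramp_at_twice a e : 0 < e ->
  twice (ramp_at a e) (fun y => step (/ e * y + - a / e)) (fun y => / e * kernel (/ e * y + - a / e)).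
Proof.
intros He. assert (H := twice_affine_comp _ _ _ (/ e) (- a / e) ramp_twice).
assert (H1 := twice_lin _ _ _ _ _ _ e 0 H (twice_const 0)).
destruct H1 as [A1 A2 A3]. split; intros y.
- apply (is_derive_ext (fun y => e * ramp (/ e * y + - a / e) + 0 * 0)); [intros; unfold ramp_at; Rring|].
  specialize (A1 y). simpl in A1.
  replace (step (/ e * y + - a / e)) with (e * (/ e * step (/ e * y + - a / e)) + 0 * 0) by (field; lra).
  exact A1.
- apply (is_derive_ext (fun y => e * (/ e * step (/ e * y + - a / e)) + 0 * 0)); [intros; Rfield; lra|].
  replace (/ e * kernel (/ e * y + - a / e)) with
   (e * (/ e * (/ e * kernel (/ e * y + - a / e))) + 0 * 0) by (field; lra).
  exact (A2 y).
- apply (continuous_ext (fun y => e * (/ e * (/ e * kernel (/ e * y + - a / e))) + 0 * 0)); [intros; Rfield; lra|].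
  exact (A3 y).
Qed.

Lemma ramp_at_smooth a e : smooth (ramp_at a e).
Proof. apply smooth_scal, (smooth_affine_comp ramp), ramp_smooth. Qed.

Lemma ramp_at_convex a e : 0 < e -> convex_fun (ramp_at a e).
Proof.
intros He. apply (convex_of_twice _ _ _ (ramp_at_twice a e He)).
intros y. apply Rmult_le_pos; [left; apply Rinv_0_lt_compat, He | apply kernel_nonneg].
Qed.

Lemma scale_le (a e y : R) : 0 < e -> y <= a -> / e * y + - a / e <= 0.
Proof.
intros He Hy. replace (/ e * y + - a / e) with (- ((a - y) * / e)) by (field; lra).
assert (0 <= (a - y) * / e); [|lra].
apply Rmult_le_pos; [lra | left; apply Rinv_0_lt_compat, He].
Qed.

Lemma scale_ge (a e y : R) : 0 < e -> a + e <= y -> 1 <= / e * y + - a / e.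
Proof.
intros He Hy. replace (/ e * y + - a / e) with (1 + (y - a - e) * / e) by (field; lra).
assert (0 <= (y - a - e) * / e); [|lra].
apply Rmult_le_pos; [lra | left; apply Rinv_0_lt_compat, He].
Qed.

Lemma ramp_at_left a e y : 0 < e -> y <= a -> ramp_at a e y = 0.
Proof. intros He Hy. unfold ramp_at. rewrite ramp_left; [ring | apply scale_le; auto]. Qed.

Lemma ramp_at_right a e y : 0 < e -> a + e <= y -> ramp_at a e y = y - a + e * (ramp 1 - 1).
Proof.
intros He Hy. unfold ramp_at. rewrite ramp_right by (apply scale_ge; auto). field. lra.
Qed.

Lemma kernel_mass a e A B : 0 < e -> A <= a -> a + e <= B ->
  RInt (fun y => / e * kernel (/ e * y + - a / e)) A B = 1.
Proof.
intros He HA HB.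
destruct (ramp_at_twice a e He) as [_ A2 A3].
rewrite (RInt_fundamental (fun y => step (/ e * y + - a / e))); [|lra|intros; apply A2|exact A3].
rewrite step_right, step_left by (apply scale_le || apply scale_ge; auto). Rring.
Qed.

(** The scaled kernels have mass one and concentrate at [a]. *)
Lemma kernel_limit g a : (forall y, continuous g y) -> forall eta, 0 < eta ->
  exists e0, 0 < e0 /\ forall e A B, 0 < e < e0 -> A <= a -> a + e <= B ->
  Rabs (RInt (fun y => / e * kernel (/ e * y + - a / e) * g y) A B - g a) <= eta.
Proof.
intros Hg eta Heta.
destruct (proj2 (continuous_eps g a) (Hg a) eta Heta) as [d [Hd Hc]].
exists d. split; [exact Hd|]. intros e A B He HA HB.
set (k := fun y => / e * kernel (/ e * y + - a / e)).
assert (Ck : forall y, continuous k y) by (apply (ramp_at_twice a e); lra).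
assert (M := kernel_mass a e A B ltac:(lra) HA HB). fold k in M.
replace (RInt (fun y => / e * kernel (/ e * y + - a / e) * g y) A B - g a)
  with (RInt (fun y => k y * (g y - g a)) A B).
2:{ rewrite (RInt_ext _ (fun y => 1 * (k y * g y) + (- g a) * k y)) by (intros; Rring).
    rewrite RInt_lin; [rewrite M; unfold k; Rring | | exact Ck].
    intros y. apply continuous_mult_R; [apply Ck | apply Hg]. }
assert (Cd : forall y : R, continuous (fun y : R => k y * (g y - g a)) y).
{ intros y. apply continuous_mult_R; [apply Ck|].
  apply continuous_minus_R; [apply Hg | apply continuous_const]. }
assert (Hpt : forall y, Rabs (k y * (g y - g a)) <= eta * k y).
{ intros y. unfold k. assert (K := kernel_nonneg (/ e * y + - a / e)).
  assert (I := Rinv_0_lt_compat e ltac:(lra)).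
  destruct (Rlt_dec a y) as [H1|H1]; [destruct (Rlt_dec y (a + e)) as [H2|H2]|].
  - assert (H := Hc y ltac:(apply Rabs_def1; lra)).
    rewrite Rabs_mult, Rabs_pos_eq by nra.
    rewrite (Rmult_comm eta). apply Rmult_le_compat_l; [nra | lra].
  - unfold kernel. rewrite bump_out by (right; apply scale_ge; lra).
    unfold Rdiv. rewrite !Rmult_0_l, !Rmult_0_r, Rmult_0_l, Rabs_R0. lra.
  - unfold kernel. rewrite bump_out by (left; apply scale_le; lra).
    unfold Rdiv. rewrite !Rmult_0_l, !Rmult_0_r, Rmult_0_l, Rabs_R0. lra. }
apply Rle_trans with (RInt (fun y => eta * k y) A B).
- apply RInt_abs_le; [lra | exact Cd | | intros y _; apply Hpt].
  intros y. apply continuous_mult_R; [apply continuous_const | apply Ck].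
- right. rewrite (RInt_ext _ (fun y => eta * k y + 0 * k y)) by (intros; Rring).
  rewrite RInt_lin by exact Ck. rewrite M. ring.
Qed.

(** * Supports, the pairing, and smoothing *)

Lemma twice_ext u u1 u2 v v1 v2 : twice u u1 u2 ->
  (forall y, v y = u y) -> (forall y, v1 y = u1 y) -> (forall y, v2 y = u2 y) -> twice v v1 v2.
Proof.
intros H E E1 E2.
apply functional_extensionality in E. apply functional_extensionality in E1.
apply functional_extensionality in E2. subst. exact H.
Qed.

(** A smoothed triangle with base $[a,b]$ and apex at [m]. The weights annihilate affine
    functions, so it vanishes beyond the three kinks. *)
Definition hat (a m b e y : R) : R :=
  (b - m) * ramp_at a e y - (b - a) * ramp_at m e y + (m - a) * ramp_at b e y.

Lemma hat_twice a m b e : 0 < e -> exists h1,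
  twice (hat a m b e) h1 (fun y =>
    (b - m) * (/ e * kernel (/ e * y + - a / e)) - (b - a) * (/ e * kernel (/ e * y + - m / e))
    + (m - a) * (/ e * kernel (/ e * y + - b / e))).
Proof.
intros He. eexists.
eapply (twice_ext _ _ _ _ _ _ (twice_lin _ _ _ _ _ _ 1 (m - a)
  (twice_lin _ _ _ _ _ _ (b - m) (- (b - a)) (ramp_at_twice a e He) (ramp_at_twice m e He))
  (ramp_at_twice b e He))).
- intros y. unfold hat. ring.
- intros y. reflexivity.
- intros y. ring.
Qed.

Lemma hat_out a m b e y : a < m < b -> 0 < e -> y < a \/ b + e < y -> hat a m b e y = 0.
Proof.
intros Hm He [H|H]; unfold hat.
- rewrite !ramp_at_left by lra. ring.
- rewrite !ramp_at_right by lra. ring.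
Qed.

Lemma hat_smooth a m b e : smooth (hat a m b e).
Proof.
intros n x.
apply (ex_derive_n_ext (fun y => ((b - m) * ramp_at a e y + - (b - a) * ramp_at m e y) + (m - a) * ramp_at b e y)).
{ intros y. unfold hat. Rring. }
revert n x.
apply (smooth_plus (fun y => (b - m) * ramp_at a e y + - (b - a) * ramp_at m e y));
 [apply (smooth_plus (fun y => (b - m) * ramp_at a e y))|]; apply smooth_scal, ramp_at_smooth.
Qed.

(** [ramp_at p e y] is convex as a function of its kink [p], and [hat] is the defect in the
    convexity inequality for the kinks [a], [m], [b]. *)
Lemma hat_nonneg a m b e y : a < m < b -> 0 < e -> 0 <= hat a m b e y.
Proof.
intros Hm He.
assert (Hr : convex_fun ramp) by (apply (convex_of_twice _ _ _ ramp_twice), kernel_nonneg).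
assert (I := Rinv_0_lt_compat e He).
assert (H := convex3 ramp (/ e * y + - b / e) (/ e * y + - m / e) (/ e * y + - a / e) Hr).
unfold Rdiv in H. specialize (H ltac:(nra)).
unfold hat, ramp_at, Rdiv.
set (A := ramp (/ e * y + - a * / e)) in *. set (M := ramp (/ e * y + - m * / e)) in *.
set (B := ramp (/ e * y + - b * / e)) in *.
apply (Rmult_le_compat_l (e * e)) in H; [|nra].
replace (e * e * ((/ e * y + - a * / e - (/ e * y + - b * / e)) * M)) with (e * ((b - a) * M)) in H by (field; lra).
replace (e * e * ((/ e * y + - a * / e - (/ e * y + - m * / e)) * B +
   (/ e * y + - m * / e - (/ e * y + - b * / e)) * A)) with (e * ((b - m) * A + (m - a) * B)) in H by (field; lra).
lra.
Qed.

Lemma dist_hat_limit g a m b : (forall y, continuous g y) -> a < m < b -> forall eta, 0 < eta ->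
  exists e0, 0 < e0 /\ forall e, 0 < e < e0 ->
  Rabs (dist_d2 g (hat a m b e) - ((b - m) * g a - (b - a) * g m + (m - a) * g b)) <= eta.
Proof.
intros Hg Hm eta Heta.
assert (Hd : 0 < eta / (2 * (b - a))) by (apply Rdiv_lt_0_compat; lra).
destruct (kernel_limit g a Hg _ Hd) as [ea [Ha Ka]].
destruct (kernel_limit g m Hg _ Hd) as [em [Hem Km]].
destruct (kernel_limit g b Hg _ Hd) as [eb [Hb Kb]].
exists (Rmin 1 (Rmin ea (Rmin em eb))).
split; [repeat apply Rmin_pos; lra|].
intros e [He Hlt].
assert (H1 : e < 1 /\ e < ea /\ e < em /\ e < eb).
{ assert (A1 := Rmin_l 1 (Rmin ea (Rmin em eb))). assert (A2 := Rmin_r 1 (Rmin ea (Rmin em eb))).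
  assert (A3 := Rmin_l ea (Rmin em eb)). assert (A4 := Rmin_r ea (Rmin em eb)).
  assert (A5 := Rmin_l em eb). assert (A6 := Rmin_r em eb). lra. }
set (L := Rabs a + Rabs b + 1).
assert (B1 := Rle_abs b). assert (B2 := Rle_abs (- a)). rewrite Rabs_Ropp in B2.
assert (B3 := Rabs_pos a). assert (B4 := Rabs_pos b).
destruct (hat_twice a m b e He) as [h1 Hh].
rewrite (dist_d2_RInt g _ _ _ L (- L) L Hh Hg); [|unfold L; lra| |lra|lra].
2:{ intros y Hy. apply hat_out; [exact Hm|exact He|]. unfold L in Hy. lra. }
specialize (Ka e (- L) L ltac:(lra) ltac:(unfold L; lra) ltac:(unfold L; lra)).
specialize (Km e (- L) L ltac:(lra) ltac:(unfold L; lra) ltac:(unfold L; lra)).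
specialize (Kb e (- L) L ltac:(lra) ltac:(unfold L; lra) ltac:(unfold L; lra)).
set (ka := fun y => / e * kernel (/ e * y + - a / e) * g y) in *.
set (km := fun y => / e * kernel (/ e * y + - m / e) * g y) in *.
set (kb := fun y => / e * kernel (/ e * y + - b / e) * g y) in *.
assert (Ck : forall p (y : R), continuous (fun y : R => / e * kernel (/ e * y + - p / e) * g y) y).
{ intros p y. apply continuous_mult_R; [|apply Hg]. apply (ramp_at_twice p e He). }
rewrite (RInt_ext _ (fun y => 1 * ((b - m) * ka y + - (b - a) * km y) + (m - a) * kb y)).
2:{ intros y _. unfold ka, km, kb. Rring. }
rewrite (RInt_lin (fun y => (b - m) * ka y + - (b - a) * km y) kb).
2:{ intros y. apply continuous_plus_R; apply continuous_mult_R; try apply continuous_const; apply Ck. }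
2:{ apply Ck. }
rewrite (RInt_lin ka km) by apply Ck.
set (Ia := RInt ka (- L) L : R) in *. set (Im := RInt km (- L) L : R) in *. set (Ib := RInt kb (- L) L : R) in *.
replace (1 * ((b - m) * Ia + - (b - a) * Im) + (m - a) * Ib - ((b - m) * g a - (b - a) * g m + (m - a) * g b))
  with ((b - m) * (Ia - g a) - (b - a) * (Im - g m) + (m - a) * (Ib - g b)) by ring.
set (d := eta / (2 * (b - a))) in *.
assert (E : eta = 2 * (b - a) * d) by (unfold d; field; lra).
apply Rabs_le_between in Ka. apply Rabs_le_between in Km. apply Rabs_le_between in Kb.
apply Rabs_le_between. rewrite E. split; nra.
Qed.

(** The value at a point is read off from the chord between two fixed points around it. *)
Lemma loc_affine_of_three (h : R -> R) x d : 0 < d -> (forall a m b, x - d < a -> a < m < b -> b < x + d ->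
  (b - a) * h m = (b - m) * h a + (m - a) * h b) -> loc_affine h x.
Proof.
intros Hd H3.
set (a := x - d / 2). set (b := x + d / 2).
assert (Hab : b - a = d) by (unfold a, b; lra).
exists (h a - (h b - h a) / (b - a) * a), ((h b - h a) / (b - a)).
exists (mkposreal (d / 2) ltac:(lra)). intros z Hz.
change (Rabs (z - x) < d / 2) in Hz. apply Rabs_def2 in Hz.
specialize (H3 a z b ltac:(unfold a; lra) ltac:(unfold a, b; lra) ltac:(unfold b; lra)).
apply (Rmult_eq_reg_l (b - a)); [|lra].
rewrite H3. field. lra.
Qed.

(** The fundamental lemma of du Bois-Reymond at second order: testing against smoothed
    hats shows that any three values of [g] near [y] are in affine position. *)
Lemma loc_affine_of_not_supp g y : (forall y, continuous g y) ->
  ~ dist_supp (dist_d2 g) y -> loc_affine g y.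
Proof.
intros Hg Hs.
assert (HU : exists U, open_set U /\ U y /\
  forall phi, test_fun phi -> included (fun_supp phi) U -> dist_d2 g phi = 0).
{ apply NNPP. intros Hno. apply Hs. intros U HU Hy. apply NNPP. intros Hn. apply Hno.
  exists U. split; [exact HU|]. split; [exact Hy|]. intros phi Ht Hi.
  apply NNPP. intros Hne. apply Hn. exists phi. auto. }
destruct HU as [U [HU [Hy HT]]]. destruct (HU y Hy) as [del Hdel].
assert (Hd := cond_pos del). set (d := del / 2).
assert (H3 : forall a m b, y - d < a -> a < m < b -> b < y + d ->
  (b - m) * g a - (b - a) * g m + (m - a) * g b = 0).
{ intros a m b Ha Hm Hb. apply NNPP. intros Hne.
  set (v := (b - m) * g a - (b - a) * g m + (m - a) * g b) in *.
  assert (Hv := Rabs_pos_lt v Hne).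
  destruct (dist_hat_limit g a m b Hg Hm (Rabs v / 2) ltac:(lra)) as [e0 [He0 Hl]].
  set (e := Rmin (e0 / 2) d).
  assert (He : 0 < e) by (apply Rmin_pos; unfold d; lra).
  assert (He1 := Rmin_l (e0 / 2) d). assert (He2 := Rmin_r (e0 / 2) d). fold e in He1, He2.
  specialize (Hl e ltac:(lra)).
  rewrite HT in Hl.
  - fold v in Hl. rewrite Rminus_0_l, Rabs_Ropp in Hl. lra.
  - apply (test_fun_segment _ a (b + e)); [apply hat_smooth|]. intros z Hz. apply hat_out; auto.
  - intros z Hz. apply Hdel. apply (supp_in_segment _ a (b + e)) in Hz;
      [|intros w Hw; apply hat_out; auto].
    unfold disc. unfold d in *. apply Rabs_def1; lra. }
apply (loc_affine_of_three g y d); [unfold d; lra|].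
intros a m b Ha Hm Hb. specialize (H3 a m b Ha Hm Hb). lra.
Qed.

(** $\int_{-M}^{M} f''g$ corrected by the boundary terms of two integrations by parts;
    it no longer depends on [M] once [g] is affine on each side of $[-M,M]$. *)
Definition pairing (g f : R -> R) (M : R) : R :=
  RInt (fun y => Derive_n f 2 y * g y) (- M) M
  - ((Derive f M * g M - f M * Derive g M) - (Derive f (- M) * g (- M) - f (- M) * Derive g (- M))).

Definition tails_affine (g : R -> R) (r : R) : Prop :=
  forall y, y < - r \/ r < y -> loc_affine g y.

Lemma supp_of_tails g r : (forall y, continuous g y) -> tails_affine g r ->
  forall y, dist_supp (dist_d2 g) y -> - r <= y <= r.
Proof.
intros Hg Ht y Hy.
destruct (Rle_dec (- r) y) as [H1|H1]; [destruct (Rle_dec y r) as [H2|H2]; [lra|]|];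
  exfalso; revert Hy; apply loc_affine_outside_supp; auto; apply Ht; lra.
Qed.

Lemma pairing_independent g f M N : (forall y, continuous g y) -> C2 f -> 0 < M <= N ->
  (forall y, y <= - M \/ M <= y -> loc_affine g y) -> pairing g f M = pairing g f N.
Proof.
intros Hg Hf HMN Ha. assert (Hu := C2_twice f Hf). unfold pairing.
assert (Hc : forall y : R, continuous (fun y : R => Derive_n f 2 y * g y) y).
{ intros y. apply continuous_mult_R; [apply Hu | apply Hg]. }
rewrite (RInt_split _ (- N) (- M) N Hc), (RInt_split _ (- M) M N Hc).
rewrite (parts_loc_affine f _ _ g (- N) (- M) Hu Hg); [|lra|intros y Hy; left; apply Ha; lra].
rewrite (parts_loc_affine f _ _ g M N Hu Hg); [|lra|intros y Hy; left; apply Ha; lra].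
ring.
Qed.

(** Away from the support of the second derivative of [g] the function [g] is affine,
    and near it $f-\chi f$ vanishes, so integration by parts applies to $f-\chi f$ on
    any interval, whatever the shape of the support. *)
Lemma pairing_value g f r M : (forall y, continuous g y) -> C2 f -> 0 < r < M ->
  tails_affine g r -> dist_d2_value g f (pairing g f M).
Proof.
intros Hg Hf HrM Ht. assert (Hu := C2_twice f Hf). split.
{ exists (plateau r). apply plateau_cutoff. exact (supp_of_tails g r Hg Ht). }
intros chi [Hchi [U [HU [HK HU1]]]].
destruct (test_fun_bounded chi Hchi) as [L [HL HLz]].
set (N := L + M).
rewrite (pairing_independent g f M N Hg Hf); [|unfold N; lra|intros y Hy; apply Ht; lra].
assert (Hphi := twice_mult _ _ _ _ _ _ (smooth_twice chi (proj1 Hchi)) Hu).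
set (phi := fun y => chi y * f y) in *.
set (phi1 := fun y => Derive chi y * f y + chi y * Derive f y) in *.
set (phi2 := fun y => Derive_n chi 2 y * f y + Derive chi y * Derive f y +
      (Derive chi y * Derive f y + chi y * Derive_n f 2 y)) in *.
assert (Hz : forall y, y < - L \/ L < y -> phi y = 0).
{ intros y Hy. unfold phi. rewrite HLz by exact Hy. ring. }
rewrite (dist_d2_RInt g phi phi1 phi2 L (- N) N Hphi Hg HL Hz) by (unfold N; lra).
assert (Hv := twice_lin _ _ _ _ _ _ 1 (- 1) Hu Hphi).
assert (Hp := parts_loc_affine _ _ _ g (- N) N Hv Hg ltac:(unfold N; lra)).
assert (Hb : forall y, y < - L \/ L < y -> phi y = 0 /\ phi1 y = 0).
{ intros y Hy. destruct (twice_locally_zero phi phi1 phi2 y Hphi) as [E [E1 _]]; [|auto].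
  generalize (locally_out L y Hy). apply filter_imp, Hz. }
destruct (Hb N ltac:(unfold N; lra)) as [E1 E2].
destruct (Hb (- N) ltac:(unfold N; lra)) as [E3 E4].
cbv beta in Hp. rewrite E1, E2, E3, E4 in Hp.
assert (Cf : forall y : R, continuous (fun y : R => Derive_n f 2 y * g y) y).
{ intros y. apply continuous_mult_R; [apply Hu | apply Hg]. }
assert (Cp : forall y : R, continuous (fun y : R => phi2 y * g y) y).
{ intros y. apply continuous_mult_R; [apply Hphi | apply Hg]. }
rewrite (RInt_ext _ (fun y => 1 * (Derive_n f 2 y * g y) + (- 1) * (phi2 y * g y))) in Hp
  by (intros; Rring).
rewrite (RInt_lin _ _ _ _ _ _ Cf Cp) in Hp.
unfold pairing. unfold Rminus in *.
enough (Hall : forall y, - N <= y <= N -> loc_affine g y \/ locally y (fun z => 1 * f z + -1 * phi z = 0)).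
{ specialize (Hp Hall). lra. }
intros y _. destruct (classic (dist_supp (dist_d2 g) y)) as [Hs|Hs].
- right. destruct (HU y (HK y Hs)) as [del Hdel]. exists del. intros z Hzd.
  unfold phi. rewrite (HU1 z (Hdel z Hzd)). Rring.
- left. apply loc_affine_of_not_supp; auto.
Qed.

Lemma dist_d2_value_unique g f v w : dist_d2_value g f v -> dist_d2_value g f w -> v = w.
Proof. intros [[chi Hc] H1] [_ H2]. rewrite (H1 chi Hc), (H2 chi Hc). reflexivity. Qed.

Definition primitive2 (f : R -> R) (y : R) : R := RInt (fun t => RInt f 0 t) 0 y.

(** The average of [f] against the tent of width $2h$, in closed form. *)
Definition tent_average (h : R) (f : R -> R) (y : R) : R :=
  (primitive2 f (y + h) - 2 * primitive2 f y + primitive2 f (y - h)) / h ^ 2.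

Lemma primitive2_twice f : (forall y, continuous f y) -> twice (primitive2 f) (fun y => RInt f 0 y) f.
Proof.
intros Hf. assert (H : forall y, is_derive (fun t => RInt f 0 t) y (f y)) by (intros; apply is_derive_primitive, Hf).
split; [|exact H|exact Hf].
intros y. apply is_derive_primitive. intros z. apply ex_derive_continuous_R. exists (f z). apply H.
Qed.

Lemma second_difference_twice f y : (forall y, continuous f y) ->
  twice (fun t => primitive2 f (y + t) - 2 * primitive2 f y + primitive2 f (y - t))
   (fun t => RInt f 0 (y + t) - RInt f 0 (y - t)) (fun t => f (y + t) + f (y - t)).
Proof.
intros Hf. assert (H := primitive2_twice f Hf).
apply (twice_ext _ _ _ _ _ _ (twice_lin _ _ _ _ _ _ 1 1
  (twice_lin _ _ _ _ _ _ 1 1 (twice_affine_comp _ _ _ 1 y H) (twice_affine_comp _ _ _ (-1) y H))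
  (twice_const (- 2 * primitive2 f y))));
intros t; replace (1 * t + y) with (y + t) by ring; replace (-1 * t + y) with (y - t) by ring; Rring.
Qed.

(** Used with [D] a second difference as a function of its step, which turns bounds on [f]
    into bounds on its tent average. *)
Lemma nonpos_of_second_derivative D D1 D2 h : twice D D1 D2 -> D 0 = 0 -> D1 0 = 0 -> 0 < h ->
  (forall t, 0 <= t <= h -> D2 t <= 0) -> D h <= 0.
Proof.
intros [A1 A2 _] H0 H1 Hh Hneg.
destruct (mean_value D D1 0 h A1 Hh) as [c [Hc E]].
assert (D1 c <= 0).
{ destruct (Req_dec c 0) as [->|Hne]; [lra|].
  destruct (mean_value D1 D2 0 c A2) as [d [Hd E']]; [lra|]. specialize (Hneg d). nra. }
nra.
Qed.

Lemma tent_average_le f g h y : (forall y, continuous f y) -> (forall y, continuous g y) -> 0 < h ->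
  (forall t, 0 <= t <= h -> f (y + t) + f (y - t) <= g (y + t) + g (y - t)) ->
  tent_average h f y <= tent_average h g y.
Proof.
intros Hf Hg Hh H.
assert (T := twice_lin _ _ _ _ _ _ 1 (- 1) (second_difference_twice f y Hf) (second_difference_twice g y Hg)).
apply (nonpos_of_second_derivative _ _ _ h) in T.
- unfold tent_average, Rdiv. apply Rmult_le_compat_r; [left; apply Rinv_0_lt_compat, pow_lt, Hh | lra].
- rewrite Rplus_0_r, Rminus_0_r. ring.
- rewrite Rplus_0_r, Rminus_0_r. Rring.
- exact Hh.
- intros t Ht. specialize (H t Ht). lra.
Qed.

Lemma tent_average_const h c y : 0 < h -> tent_average h (fun _ => c) y = c.
Proof.
intros Hh. unfold tent_average.
assert (E : forall z, primitive2 (fun _ => c) z = c * z ^ 2 / 2).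
{ intros z. unfold primitive2.
  assert (Hd : forall x, is_derive (fun x => c * x ^ 2 / 2) x (RInt (fun _ => c) 0 x)).
  { intros x. rewrite RInt_const. unfold scal; simpl; unfold mult; simpl. auto_derive; [exact I | field]. }
  apply is_RInt_unique.
  replace (c * z ^ 2 / 2) with (minus (c * z ^ 2 / 2) (c * 0 ^ 2 / 2)).
  - apply (is_RInt_derive (fun x => c * x ^ 2 / 2) (fun t => RInt (fun _ => c) 0 t)).
    + intros x _. apply Hd.
    + intros x _. apply ex_derive_continuous_R. exists c.
      apply (is_derive_primitive (fun _ => c)). intros; apply continuous_const.
  - unfold minus, plus, opp; simpl. field. }
rewrite !E. field. lra.
Qed.

Lemma tent_average_close f h y eps : (forall y, continuous f y) -> 0 < h ->
  (forall t, 0 <= t <= h -> Rabs (f (y + t) - f y) <= eps /\ Rabs (f (y - t) - f y) <= eps) ->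
  Rabs (tent_average h f y - f y) <= eps.
Proof.
intros Hf Hh H.
assert (Cc : forall c y : R, continuous (fun _ : R => c) y) by (intros; apply continuous_const).
assert (H1 := tent_average_le f (fun _ => f y + eps) h y Hf (Cc _) Hh).
assert (H2 := tent_average_le (fun _ => f y - eps) f h y (Cc _) Hf Hh).
rewrite tent_average_const in H1, H2 by exact Hh.
apply Rabs_le_between. split.
- enough (f y - eps <= tent_average h f y) by lra. apply H2. intros t Ht. destruct (H t Ht) as [B1 B2].
  apply Rabs_le_between in B1. apply Rabs_le_between in B2. lra.
- enough (tent_average h f y <= f y + eps) by lra. apply H1. intros t Ht. destruct (H t Ht) as [B1 B2].
  apply Rabs_le_between in B1. apply Rabs_le_between in B2. lra.
Qed.

Lemma tent_average_twice f h : (forall y, continuous f y) -> 0 < h -> exists u1,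
  twice (tent_average h f) u1 (fun y => (f (y + h) - 2 * f y + f (y - h)) / h ^ 2).
Proof.
intros Hf Hh. assert (H := primitive2_twice f Hf). eexists.
apply (twice_ext _ _ _ _ _ _ (twice_lin _ _ _ _ _ _ (/ h ^ 2) (- 2 * / h ^ 2)
  (twice_lin _ _ _ _ _ _ 1 1 (twice_affine_comp _ _ _ 1 h H) (twice_affine_comp _ _ _ 1 (- h) H))
  H)).
- intros y. unfold tent_average, Rminus. rewrite !Rmult_1_l. unfold Rdiv. ring.
- intros y. reflexivity.
- intros y. rewrite !Rmult_1_l. unfold Rdiv, Rminus. ring.
Qed.

(** The second derivative of the tent average is a second difference quotient of [f]. *)
Lemma tent_average_convex f h : convex_fun f -> 0 < h -> convex_fun (tent_average h f).
Proof.
intros Hf Hh.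
destruct (tent_average_twice f h (fun y => convex_continuous f y Hf) Hh) as [u1 Hu].
apply (convex_of_twice _ _ _ Hu). intros y.
apply Rmult_le_pos; [|left; apply Rinv_0_lt_compat, pow_lt, Hh].
assert (H := convex3 f (y - h) y (y + h) Hf ltac:(lra)). nra.
Qed.

Definition mollify (n : nat) (f : Conv) : Conv :=
  mkConv (tent_average (unit_frac n) f)
    (tent_average_convex f _ (conv_fun_convex f) (unit_frac_pos n)).

Lemma conv_continuous (f : Conv) y : continuous f y.
Proof. apply convex_continuous, conv_fun_convex. Qed.

Lemma mollify_C2 n f : C2 (mollify n f).
Proof.
destruct (tent_average_twice f (unit_frac n) (conv_continuous f) (unit_frac_pos n)) as [u1 Hu].
exact (twice_C2 _ _ _ Hu).
Qed.

Lemma mollify_le n (f g : Conv) : (forall x, f x <= g x) -> forall x, mollify n f x <= mollify n g x.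
Proof.
intros H x. apply tent_average_le; try apply conv_continuous; [apply unit_frac_pos|].
intros t _. apply Rplus_le_compat; apply H.
Qed.

(** With [mollify_C2] this is the density of the $C^2$ functions in [Conv]. *)
Lemma mollify_lim f x : is_lim_seq (fun n => mollify n f x) (f x).
Proof.
apply is_lim_seq_eps. intros eps He.
destruct (proj2 (continuous_eps f x) (conv_continuous f x) (eps / 2) ltac:(lra)) as [d [Hd Hc]].
generalize (proj2 (is_lim_seq_eps unit_frac 0) unit_frac_lim d Hd). apply filter_imp.
intros n Hn. rewrite Rminus_0_r, Rabs_pos_eq in Hn by (left; apply unit_frac_pos).
apply Rle_lt_trans with (eps / 2); [|lra].
apply tent_average_close; [apply conv_continuous | apply unit_frac_pos|].
intros t Ht. split; left; apply Hc; apply Rabs_def1; lra.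
Qed.

(** * Additive continuous functionals *)

Definition pointwise_continuous (T : Conv -> R) : Prop :=
  forall (fs : nat -> Conv) (f : Conv),
    (forall y, is_lim_seq (fun n => fs n y) (f y)) -> is_lim_seq (fun n => T (fs n)) (T f).

Definition additive_functional (T : Conv -> R) : Prop :=
  forall g h, T (conv_add g h) = T g + T h.

Lemma functional_ext T (f g : Conv) : pointwise_continuous T -> (forall y, f y = g y) -> T f = T g.
Proof.
intros HT E.
assert (H : is_lim_seq (fun _ => T f) (T g)).
{ apply (HT (fun _ => f) g). intros y. rewrite E. apply is_lim_seq_const. }
apply is_lim_seq_unique in H. rewrite Lim_seq_const in H. injection H. auto.
Qed.

Lemma functional_add T (f g h : Conv) : pointwise_continuous T -> additive_functional T ->
  (forall y, f y = g y + h y) -> T f = T g + T h.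
Proof. intros HT HA E. rewrite <- HA. apply functional_ext; [exact HT | exact E]. Qed.

Lemma convex_scal c f : 0 <= c -> convex_fun f -> convex_fun (fun x => c * f x).
Proof. intros Hc Hf x y t Ht. specialize (Hf x y t Ht). nra. Qed.

Definition conv_scal (c : R) (Hc : 0 <= c) (f : Conv) : Conv :=
  mkConv (fun x => c * f x) (convex_scal c f Hc (conv_fun_convex f)).

Lemma convex_affine c d : convex_fun (fun x => c + d * x).
Proof. intros x y t Ht. right. ring. Qed.

Definition conv_affine (c d : R) : Conv := mkConv (fun x => c + d * x) (convex_affine c d).

Lemma functional_zero T : pointwise_continuous T -> additive_functional T -> T (conv_affine 0 0) = 0.
Proof.
intros HT HA.
assert (H := functional_add T (conv_affine 0 0) (conv_affine 0 0) (conv_affine 0 0) HT HA).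
simpl in H. specialize (H ltac:(intros; ring)). lra.
Qed.

Lemma functional_nat T f (n : nat) : pointwise_continuous T -> additive_functional T ->
  T (conv_scal (INR n) (pos_INR n) f) = INR n * T f.
Proof.
intros HT HA. induction n as [|n IH].
- rewrite (functional_ext T _ (conv_affine 0 0) HT) by (intros; simpl; ring).
  rewrite functional_zero by assumption. simpl. ring.
- rewrite (functional_add T _ (conv_scal (INR n) (pos_INR n) f) f HT HA).
  + rewrite IH, S_INR. ring.
  + intros y. unfold conv_scal, conv_fun; fold conv_fun. rewrite S_INR. ring.
Qed.

Lemma nat_fraction_approx c : 0 <= c -> exists p : nat -> nat,
  is_lim_seq (fun n => INR (p n) * unit_frac n) c.
Proof.
intros Hc.
assert (Hn : forall n, 0 <= c * (INR n + 1)).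
{ intros n. assert (H := pos_INR n). nra. }
exists (fun n => proj1_sig (nfloor_ex _ (Hn n))).
apply is_lim_seq_le_le with (u := fun n => c - unit_frac n) (w := fun _ => c).
- intros n. destruct (nfloor_ex _ (Hn n)) as [p [H1 H2]]; simpl.
  assert (H := unit_frac_pos n). assert (E : (INR n + 1) * unit_frac n = 1).
  { unfold unit_frac. field. assert (H3 := pos_INR n). lra. }
  split.
  + apply (Rmult_le_compat_r (unit_frac n)) in H1; [|lra].
    assert (H2' : c * (INR n + 1) * unit_frac n <= (INR p + 1) * unit_frac n) by (apply Rmult_le_compat_r; lra).
    rewrite Rmult_assoc, E in H2'. lra.
  + apply (Rmult_le_compat_r (unit_frac n)) in H1; [|lra]. rewrite Rmult_assoc, E in H1. lra.
- replace (Finite c) with (Finite (c - 0)) by (f_equal; ring).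
  apply is_lim_seq_minus'; [apply is_lim_seq_const | apply unit_frac_lim].
- apply is_lim_seq_const.
Qed.

(** Additivity gives homogeneity for natural factors, hence for fractions, and continuity
    extends it to real factors. *)
Lemma functional_homogeneous T (f g : Conv) c : pointwise_continuous T -> additive_functional T ->
  0 <= c -> (forall y, g y = c * f y) -> T g = c * T f.
Proof.
intros HT HA Hc E.
destruct (nat_fraction_approx c Hc) as [p Hp].
assert (Hq : forall n, 0 <= INR (p n) * unit_frac n).
{ intros n. apply Rmult_le_pos; [apply pos_INR | left; apply unit_frac_pos]. }
assert (Hf : forall n, T (conv_scal _ (Hq n) f) = INR (p n) * unit_frac n * T f).
{ intros n.
  assert (E1 := functional_nat T (conv_scal _ (Hq n) f) (S n) HT HA).
  assert (E2 := functional_nat T f (p n) HT HA).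
  rewrite (functional_ext T _ (conv_scal (INR (p n)) (pos_INR (p n)) f) HT), E2 in E1.
  - rewrite S_INR in E1.
    apply (Rmult_eq_reg_l (INR n + 1)); [|assert (H3 := pos_INR n); lra].
    rewrite <- E1. unfold unit_frac. field. assert (H3 := pos_INR n); lra.
  - intros y. unfold conv_scal, conv_fun; fold conv_fun. rewrite S_INR. unfold unit_frac. field. assert (H3 := pos_INR n); lra. }
assert (L1 : is_lim_seq (fun n => T (conv_scal _ (Hq n) f)) (T g)).
{ apply HT. intros y. rewrite E. simpl.
  apply is_lim_seq_mult'; [exact Hp | apply is_lim_seq_const]. }
assert (L2 : is_lim_seq (fun n => T (conv_scal _ (Hq n) f)) (c * T f)).
{ apply (is_lim_seq_ext (fun n => INR (p n) * unit_frac n * T f)); [intros; symmetry; apply Hf|].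
  apply is_lim_seq_mult'; [exact Hp | apply is_lim_seq_const]. }
apply is_lim_seq_unique in L1. apply is_lim_seq_unique in L2.
rewrite L1 in L2. injection L2. auto.
Qed.

Lemma functional_affine T c d : pointwise_continuous T -> additive_functional T ->
  T (conv_affine c d) = c * T (conv_affine 1 0) + d * T (conv_affine 0 1).
Proof.
intros HT HA.
(* a line through the origin of the affine functions carries an additive, hence odd, function *)
assert (Hline : forall k p q, T (conv_affine (k * p) (k * q)) = k * T (conv_affine p q)).
{ intros k p q. destruct (Rle_dec 0 k) as [Hk|Hk].
  - apply functional_homogeneous; auto. intros y; simpl; ring.
  - assert (H1 : T (conv_affine ((- k) * p) ((- k) * q)) = (- k) * T (conv_affine p q)).
    { apply functional_homogeneous; auto; [lra|]. intros y; simpl; ring. }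
    assert (H2 : T (conv_affine 0 0) =
      T (conv_affine (k * p) (k * q)) + T (conv_affine ((- k) * p) ((- k) * q))).
    { apply functional_add; auto. intros y; simpl; ring. }
    rewrite functional_zero in H2 by assumption. lra. }
rewrite (functional_add T _ (conv_affine (c * 1) (c * 0)) (conv_affine (d * 0) (d * 1)) HT HA).
- rewrite !Hline. reflexivity.
- intros y. simpl. ring.
Qed.

(** The end points bound [h] from above, and the mean of the values at [x] and [- x] bounds
    it from below; hence pointwise limits are uniform on segments. *)
Lemma convex_bound_center h M x : convex_fun h -> Rabs x <= M ->
  Rabs (h x) <= 2 * Rabs (h 0) + Rabs (h M) + Rabs (h (- M)).
Proof.
intros Hh Hx. apply Rabs_le_between in Hx.
destruct (Req_dec M 0) as [->|HM].
{ replace x with 0 by lra. assert (H1 := Rabs_pos (h 0)). assert (H2 := Rabs_pos (h (- 0))). lra. }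
assert (Hup : forall y, - M <= y <= M -> h y <= Rabs (h M) + Rabs (h (- M))).
{ intros y Hy. assert (H := convex3 h (- M) y M Hh Hy).
  assert (H1 := Rle_abs (h M)). assert (H2 := Rle_abs (h (- M))).
  assert (H3 := Rabs_pos (h M)). assert (H4 := Rabs_pos (h (- M))).
  apply (Rmult_le_reg_l (M - - M)); [lra|]. nra. }
assert (H1 := Hup x Hx). assert (H2 := Hup (- x) ltac:(lra)).
assert (H3 := Hh x (- x) (1 / 2) ltac:(lra)).
replace (1 / 2 * x + (1 - 1 / 2) * - x) with 0 in H3 by field.
assert (H4 := Rabs_pos (h 0)).
assert (H5 := Rle_abs (- h 0)). rewrite Rabs_Ropp in H5.
apply Rabs_le_between. lra.
Qed.

(** Functions vanishing on larger and larger intervals tend to zero, however large the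
    factors they are multiplied with; so their images cannot be nonzero. *)
Lemma locality (Psi : Conv -> Conv) (M : R) :
  (forall x, pointwise_continuous (fun f => Psi f x)) ->
  (forall x, additive_functional (fun f => Psi f x)) ->
  exists r, 0 < r /\ forall (f : Conv) x, (forall y, - r <= y <= r -> f y = 0) ->
    Rabs x <= M -> Psi f x = 0.
Proof.
intros HT HA. apply NNPP. intros Hno.
assert (Hn : forall n : nat, exists fx : Conv * R, (forall y, - (INR n + 1) <= y <= INR n + 1 -> fst fx y = 0) /\
  Rabs (snd fx) <= M /\ Psi (fst fx) (snd fx) <> 0).
{ intros n. apply NNPP. intros Hn. apply Hno. exists (INR n + 1).
  split; [assert (H := pos_INR n); lra|].
  intros f x Hf Hx. apply NNPP. intros Hne. apply Hn. exists (f, x). auto. }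
set (fx := fun n => proj1_sig (constructive_indefinite_description _ (Hn n))).
assert (Hfx : forall n, (forall y, - (INR n + 1) <= y <= INR n + 1 -> fst (fx n) y = 0) /\
  Rabs (snd (fx n)) <= M /\ Psi (fst (fx n)) (snd (fx n)) <> 0).
{ intros n. exact (proj2_sig (constructive_indefinite_description _ (Hn n))). }
(* the factors k bring the images, at the points of the segment, away from zero *)
assert (Hk : forall n, exists k : nat, 1 <= INR k * Rabs (Psi (fst (fx n)) (snd (fx n)))).
{ intros n. destruct (Hfx n) as [_ [_ H]]. apply Rabs_pos_lt in H.
  destruct (nfloor_ex (/ Rabs (Psi (fst (fx n)) (snd (fx n))))) as [k [_ Hk]].
  { left. apply Rinv_0_lt_compat, H. }
  exists (S k). rewrite S_INR.
  apply (Rmult_lt_compat_r (Rabs (Psi (fst (fx n)) (snd (fx n))))) in Hk; [|exact H].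
  rewrite Rinv_l in Hk by lra. lra. }
set (k := fun n => proj1_sig (constructive_indefinite_description _ (Hk n))).
assert (Hkn : forall n, 1 <= INR (k n) * Rabs (Psi (fst (fx n)) (snd (fx n)))).
{ intros n. exact (proj2_sig (constructive_indefinite_description _ (Hk n))). }
set (g := fun n => conv_scal (INR (k n)) (pos_INR (k n)) (fst (fx n))).
assert (Hg : forall x, is_lim_seq (fun n => Psi (g n) x) 0).
{ intros x. rewrite <- (functional_zero (fun f => Psi f x) (HT x) (HA x)).
  apply (HT x). intros y. simpl.
  apply (is_lim_seq_ext_loc (fun _ => 0)).
  - destruct (nfloor_ex (Rabs y) (Rabs_pos y)) as [N [_ HN]].
    exists N. intros n Hge. apply le_INR in Hge.
    rewrite (proj1 (Hfx n)); [ring|]. apply Rabs_le_between. lra.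
  - replace (0 + 0 * y) with 0 by ring. apply is_lim_seq_const. }
assert (Hs : is_lim_seq (fun n => 2 * Rabs (Psi (g n) 0) + Rabs (Psi (g n) M) + Rabs (Psi (g n) (- M))) 0).
{ replace (Finite 0) with (Finite (2 * 0 + 0 + 0)) by (f_equal; ring).
  assert (Ha : forall x, is_lim_seq (fun n => Rabs (Psi (g n) x)) 0).
  { intros x. apply (proj1 (is_lim_seq_abs_0 _)), Hg. }
  apply is_lim_seq_plus'; [apply is_lim_seq_plus'; [apply is_lim_seq_mult'; [apply is_lim_seq_const|]|]|];
   apply Ha. }
apply is_lim_seq_eps with (eps := 1) in Hs; [|lra].
destruct Hs as [N HN]. specialize (HN N (le_n N)). rewrite Rminus_0_r in HN.
assert (H1 := convex_bound_center (Psi (g N)) M (snd (fx N)) (conv_fun_convex _) (proj1 (proj2 (Hfx N)))).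
assert (H2 := Hkn N).
assert (H3 := functional_nat (fun f => Psi f (snd (fx N))) (fst (fx N)) (k N) (HT _) (HA _)).
cbv beta in H3. unfold g in *. rewrite H3 in H1.
rewrite Rabs_mult, (Rabs_pos_eq (INR (k N))) in H1 by apply pos_INR.
assert (H4 := Rle_abs (2 * Rabs (Psi (conv_scal (INR (k N)) (pos_INR (k N)) (fst (fx N))) 0) +
      Rabs (Psi (conv_scal (INR (k N)) (pos_INR (k N)) (fst (fx N))) M) +
      Rabs (Psi (conv_scal (INR (k N)) (pos_INR (k N)) (fst (fx N))) (- M)))).
lra.
Qed.

Lemma Rmax_convex f g : convex_fun f -> convex_fun g -> convex_fun (fun x => Rmax (f x) (g x)).
Proof.
intros Hf Hg x y t Ht. specialize (Hf x y t Ht). specialize (Hg x y t Ht).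
assert (A1 := Rmax_l (f x) (g x)). assert (A2 := Rmax_r (f x) (g x)).
assert (A3 := Rmax_l (f y) (g y)). assert (A4 := Rmax_r (f y) (g y)).
apply Rmax_lub; nra.
Qed.

Lemma hinge_convex y : convex_fun (fun t => Rmax (t - y) 0).
Proof.
apply (Rmax_convex (fun t => t - y) (fun _ => 0)); intros a b t Ht; right; ring.
Qed.

Lemma hinge_left_convex y : convex_fun (fun t => Rmax (y - t) 0).
Proof.
apply (Rmax_convex (fun t => y - t) (fun _ => 0)); intros a b t Ht; right; ring.
Qed.

Definition hinge (y : R) : Conv := mkConv _ (hinge_convex y).
Definition hinge_left (y : R) : Conv := mkConv _ (hinge_left_convex y).

Lemma hinge_continuous t y : continuous (fun s => Rmax (t - s) 0) y.
Proof. exact (conv_continuous (hinge_left t) y). Qed.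

Lemma functional_hinge_continuous T y : pointwise_continuous T -> continuous (fun s => T (hinge s)) y.
Proof.
intros HT. apply continuous_by_sequences. intros u Hu. apply HT. intros t. simpl.
apply (is_lim_seq_continuous (fun s => Rmax (t - s) 0)); [|exact Hu].
apply continuity_pt_filterlim, hinge_continuous.
Qed.

(** The average over $[s,s+h]$ of $w(y)\,(t-y)_+$. Integrating over the unit interval gives
    it a meaning, and makes it convex in [t], also when [h] is negative, so that it serves
    for two-sided difference quotients. *)
Definition hinge_average (w : R -> R) (s h t : R) : R :=
  RInt (fun u => Rmax (t - (h * u + s)) 0 * w (h * u + s)) 0 1.

Lemma hinge_average_integrand w s h t (u : R) : (forall y, continuous w y) ->
  continuous (fun u : R => Rmax (t - (h * u + s)) 0 * w (h * u + s)) u.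
Proof.
intros Hw.
apply (continuous_comp (fun u => h * u + s) (fun y => Rmax (t - y) 0 * w y)).
- apply ex_derive_continuous_R. auto_derive. exact I.
- apply continuous_mult_R; [apply hinge_continuous | apply Hw].
Qed.

Lemma hinge_average_convex w s h : (forall y, continuous w y) -> (forall y, 0 <= w y) ->
  convex_fun (hinge_average w s h).
Proof.
intros Hw Hp x y t Ht. unfold hinge_average.
assert (C := fun z u => hinge_average_integrand w s h z u Hw).
rewrite <- (RInt_lin _ _ t (1 - t) 0 1 (C x) (C y)).
apply RInt_le; [lra | apply ex_RInt_cont, C | |].
- apply ex_RInt_cont. intros u.
  apply continuous_plus_R; (apply continuous_mult_R; [apply continuous_const | apply C]).
- intros u _. set (z := h * u + s).
  assert (H := hinge_convex z x y t Ht). specialize (Hp z). cbv beta in H. nra.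
Qed.

Lemma hinge_average_scal w s h t : (forall y, continuous w y) ->
  h * hinge_average w s h t = RInt (fun y => Rmax (t - y) 0 * w y) s (s + h).
Proof.
intros Hw. unfold hinge_average.
assert (Hc : forall y : R, continuous (fun y : R => Rmax (t - y) 0 * w y) y).
{ intros y. apply continuous_mult_R; [apply hinge_continuous | apply Hw]. }
assert (H := RInt_comp_lin (fun y : R => Rmax (t - y) 0 * w y) h s 0 1 (ex_RInt_cont _ _ _ Hc)).
replace (h * 0 + s) with s in H by ring. replace (h * 1 + s) with (s + h) in H by ring.
rewrite <- H. symmetry.
apply (RInt_scal (fun u => Rmax (t - (h * u + s)) 0 * w (h * u + s)) 0 1 h).
apply ex_RInt_cont. intros u. apply hinge_average_integrand, Hw.
Qed.

Lemma hinge_average_lim w s t (hs : nat -> R) : (forall y, continuous w y) -> is_lim_seq hs 0 ->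
  is_lim_seq (fun n => hinge_average w s (hs n) t) (w s * Rmax (t - s) 0).
Proof.
intros Hw Hh. apply is_lim_seq_eps. intros eps He.
assert (Hc : continuous (fun y : R => Rmax (t - y) 0 * w y) s).
{ apply continuous_mult_R; [apply hinge_continuous | apply Hw]. }
destruct (proj2 (continuous_eps _ s) Hc (eps / 2) ltac:(lra)) as [d [Hd Hy]].
generalize (proj2 (is_lim_seq_eps hs 0) Hh d Hd). apply filter_imp. intros n Hn.
rewrite Rminus_0_r in Hn.
assert (C := fun u => hinge_average_integrand w s (hs n) t u Hw).
assert (Hb : forall u, 0 < u < 1 -> Rabs (Rmax (t - (hs n * u + s)) 0 * w (hs n * u + s) - Rmax (t - s) 0 * w s) < eps / 2).
{ intros u Hu. apply Hy. replace (hs n * u + s - s) with (hs n * u) by ring.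
  rewrite Rabs_mult, (Rabs_pos_eq u) by lra. assert (H := Rabs_pos (hs n)). nra. }
assert (Hup : hinge_average w s (hs n) t <= RInt (fun _ => Rmax (t - s) 0 * w s + eps / 2) 0 1).
{ apply RInt_le; [lra | apply ex_RInt_cont, C | apply ex_RInt_cont; intros; apply continuous_const|].
  intros u Hu. specialize (Hb u Hu). apply Rabs_def2 in Hb. lra. }
assert (Hlo : RInt (fun _ => Rmax (t - s) 0 * w s - eps / 2) 0 1 <= hinge_average w s (hs n) t).
{ apply RInt_le; [lra | apply ex_RInt_cont; intros; apply continuous_const | apply ex_RInt_cont, C|].
  intros u Hu. specialize (Hb u Hu). apply Rabs_def2 in Hb. lra. }
rewrite RInt_const in Hup, Hlo. unfold scal in Hup, Hlo; simpl in Hup, Hlo; unfold mult in Hup, Hlo; simpl in Hup, Hlo.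
apply Rabs_def1; lra.
Qed.

Definition conv_hinges (w : R -> R) (Hw : forall y, continuous w y) (Hp : forall y, 0 <= w y) (s h : R) : Conv :=
  mkConv (hinge_average w s h) (hinge_average_convex w s h Hw Hp).

(** As a function of the upper limit of integration, the value of [T] has derivative $w(s)$
    times its value at the hinge with kink [s]; so [T] passes under the integral sign. *)
Lemma functional_integral T w Hw Hp a b : pointwise_continuous T -> additive_functional T -> a <= b ->
  (b - a) * T (conv_hinges w Hw Hp a (b - a)) = RInt (fun y => w y * T (hinge y)) a b.
Proof.
intros HT HA Hab.
set (G := fun p q => (q - p) * T (conv_hinges w Hw Hp p (q - p))).
assert (Hch : forall p q r, p <= q <= r -> G p r = G p q + G q r).
{ intros p q r Hr. unfold G.
  assert (H1 : 0 <= q - p) by lra. assert (H2 : 0 <= r - q) by lra. assert (H3 : 0 <= r - p) by lra.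
  rewrite <- (functional_homogeneous T _ (conv_scal _ H1 (conv_hinges w Hw Hp p (q - p))) _ HT HA H1) by reflexivity.
  rewrite <- (functional_homogeneous T _ (conv_scal _ H2 (conv_hinges w Hw Hp q (r - q))) _ HT HA H2) by reflexivity.
  rewrite <- (functional_homogeneous T _ (conv_scal _ H3 (conv_hinges w Hw Hp p (r - p))) _ HT HA H3) by reflexivity.
  apply functional_add; [exact HT | exact HA|]. intros t. simpl.
  rewrite !hinge_average_scal by exact Hw.
  replace (p + (q - p)) with q by ring. replace (p + (r - p)) with r by ring. replace (q + (r - q)) with r by ring.
  apply RInt_split. intros y. apply continuous_mult_R; [apply hinge_continuous | apply Hw]. }
(* starting the integral at a - 1 makes the derivative at a two-sided *)
assert (Hder : forall s, a <= s -> is_derive (fun q => G (a - 1) q) s (w s * T (hinge s))).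
{ intros s Hs. apply is_derive_Reals. intros eps He.
  destruct (limit_by_sequences (fun h => h <> 0 /\ a - 1 <= s + h)
     (fun h => (G (a - 1) (s + h) - G (a - 1) s) / h) 0 (w s * T (hinge s))) with (eps := eps) as [d [Hd Hlim]].
  - intros u Hu Hul.
    apply (is_lim_seq_ext (fun n => T (conv_hinges w Hw Hp s (u n)))).
    + intros n. destruct (Hu n) as [Hn0 Hn1].
      destruct (Rle_dec 0 (u n)) as [Hpos|Hneg].
      * rewrite (Hch (a - 1) s (s + u n)) by lra. unfold G at 2.
        replace (s + u n - s) with (u n) by ring. field. exact Hn0.
      * rewrite (Hch (a - 1) (s + u n) s) by lra. unfold G at 3.
        replace (s - (s + u n)) with (- u n) by ring.
        rewrite (functional_ext T (conv_hinges w Hw Hp (s + u n) (- u n)) (conv_hinges w Hw Hp s (u n)) HT).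
        { field. exact Hn0. }
        intros t. simpl. apply (Rmult_eq_reg_l (u n)); [|exact Hn0].
        rewrite (hinge_average_scal w s (u n) t Hw).
        replace (u n * hinge_average w (s + u n) (- u n) t)
         with (- (- u n * hinge_average w (s + u n) (- u n) t)) by ring.
        rewrite (hinge_average_scal w (s + u n) (- u n) t Hw).
        replace (s + u n + - u n) with s by ring.
        assert (Hsw := opp_RInt_swap (fun y => Rmax (t - y) 0 * w y) (s + u n) s).
        simpl in Hsw. unfold opp in Hsw; simpl in Hsw. apply Hsw.
        apply ex_RInt_cont. intros y. apply continuous_mult_R; [apply hinge_continuous | apply Hw].
    + rewrite <- (functional_homogeneous T (hinge s) (conv_scal (w s) (Hp s) (hinge s)) (w s) HT HA (Hp s)) by reflexivity.
      apply HT. intros t. apply hinge_average_lim; [exact Hw | exact Hul].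
  - exact He.
  - assert (Hm : 0 < Rmin d 1) by (apply Rmin_pos; lra).
    exists (mkposreal _ Hm). intros h Hh0 Hh. simpl in Hh.
    assert (Hm1 := Rmin_l d 1). assert (Hm2 := Rmin_r d 1).
    apply (Hlim h).
    + split; [exact Hh0|]. apply Rabs_def2 in Hh. lra.
    + rewrite Rminus_0_r. lra. }
rewrite (RInt_fundamental (fun q => G (a - 1) q)).
- rewrite (Hch (a - 1) a b) by lra. unfold G. ring.
- exact Hab.
- intros s Hs. apply Hder. lra.
- intros y. apply continuous_mult_R; [apply Hw | apply functional_hinge_continuous, HT].
Qed.

(** * The kernel of an additive continuous map *)

(** Taylor's formula with integral remainder. *)
Lemma hinge_representation f a b t : C2 f -> a <= t <= b ->
  RInt (fun y => Rmax (t - y) 0 * Derive_n f 2 y) a b = f t - f a - Derive f a * (t - a).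
Proof.
intros Hf Ht. assert (Hu := C2_twice f Hf). destruct Hu as [A1 A2 A3].
assert (Hc : forall y : R, continuous (fun y : R => Rmax (t - y) 0 * Derive_n f 2 y) y).
{ intros y. apply continuous_mult_R; [apply hinge_continuous | apply A3]. }
rewrite (RInt_split _ a t b Hc).
rewrite (RInt_zero _ t b).
2:{ intros y Hy. rewrite Rmin_left in Hy by lra. rewrite Rmax_right by lra. ring. }
rewrite (RInt_ext _ (fun y => (t - y) * Derive_n f 2 y)).
2:{ intros y Hy. rewrite Rmax_right in Hy by lra. rewrite Rmax_left by lra. reflexivity. }
rewrite (RInt_fundamental (fun y => (t - y) * Derive f y + f y)); [Rring | lra | |].
- intros y _.
  replace ((t - y) * Derive_n f 2 y) with ((-1 * Derive f y + (t - y) * Derive_n f 2 y) + Derive f y) by ring.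
  apply (is_derive_plus (fun y => (t - y) * Derive f y) f); [|apply A1].
  apply (is_derive_mult (fun y => t - y) (Derive f)); [|apply A2|intros; apply Rmult_comm].
  auto_derive; [exact I | ring].
- intros y. apply continuous_mult_R; [|apply A3].
  apply ex_derive_continuous_R. auto_derive. exact I.
Qed.

Lemma C2_convex_nonneg (f : Conv) : C2 f -> forall y, 0 <= Derive_n f 2 y.
Proof. intros Hf y. exact (convex_twice_nonneg f _ _ y (conv_fun_convex f) (C2_twice f Hf)). Qed.

(** The function [g] continues [f] by its tangents at [a] and [b]; it is an affine function
    plus a superposition of hinges, on which [T] is known. *)
Lemma functional_affine_extension T (f : Conv) a b (Hf : C2 f) : pointwise_continuous T -> additive_functional T ->
  a <= b -> exists g : Conv, (forall t, a <= t <= b -> g t = f t) /\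
  T g = (f a - Derive f a * a) * T (conv_affine 1 0) + Derive f a * T (conv_affine 0 1)
        + RInt (fun y => Derive_n f 2 y * T (hinge y)) a b.
Proof.
intros HT HA Hab.
assert (Hw := twice_cont _ _ _ (C2_twice f Hf)). assert (Hp := C2_convex_nonneg f Hf).
assert (Hba : 0 <= b - a) by lra.
set (h := conv_scal (b - a) Hba (conv_hinges _ Hw Hp a (b - a))).
exists (conv_add (conv_affine (f a - Derive f a * a) (Derive f a)) h). split.
- intros t Ht.
  change (f a - Derive f a * a + Derive f a * t + (b - a) * hinge_average (Derive_n f 2) a (b - a) t = f t).
  rewrite hinge_average_scal by exact Hw.
  replace (a + (b - a)) with b by ring. 
  rewrite (hinge_representation f a b t Hf Ht). ring.
- rewrite HA, functional_affine by assumption. f_equal.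
  rewrite <- (functional_integral T _ Hw Hp a b HT HA Hab).
  apply functional_homogeneous; [exact HT | exact HA | exact Hba | reflexivity].
Qed.

(** A hinge with its kink far to the left is an affine function on the relevant interval. *)
Lemma functional_hinge_tails T r : pointwise_continuous T -> additive_functional T ->
  (forall f : Conv, (forall y, - r <= y <= r -> f y = 0) -> T f = 0) ->
  (forall y, r < y -> T (hinge y) = 0) /\
  (forall y, y < - r -> T (hinge y) = T (conv_affine 0 1) - y * T (conv_affine 1 0)).
Proof.
intros HT HA Hloc. split; intros y Hy.
- apply Hloc. intros t Ht. simpl. rewrite Rmax_right; lra.
- rewrite (functional_add T _ (conv_affine (- y) 1) (hinge_left y) HT HA).
  + rewrite functional_affine by assumption. rewrite (Hloc (hinge_left y)); [ring|].
    intros t Ht. simpl. rewrite Rmax_right; lra.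
  + intros t. simpl. unfold Rmax. destruct (Rle_dec (t - y) 0); destruct (Rle_dec (y - t) 0); lra.
Qed.

Lemma locally_gt a y : a < y -> locally y (fun z => a < z).
Proof. intros H. apply (locally_interval _ y (Finite a) p_infty); simpl; auto. Qed.

Lemma locally_lt a y : y < a -> locally y (fun z => z < a).
Proof. intros H. apply (locally_interval _ y m_infty (Finite a)); simpl; auto. Qed.

(** The tangential continuations of [f] from $[-N,N]$ tend to [f] as [N] grows, and their
    values are the pairings over $[-N,N]$, which do not depend on [N]. *)
Lemma functional_pairing T (f : Conv) r : pointwise_continuous T -> additive_functional T -> 0 < r ->
  (forall f : Conv, (forall y, - r <= y <= r -> f y = 0) -> T f = 0) -> C2 f ->
  tails_affine (fun y => T (hinge y)) r /\ T f = pairing (fun y => T (hinge y)) f (r + 1).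
Proof.
intros HT HA Hr Hloc Hf.
destruct (functional_hinge_tails T r HT HA Hloc) as [Hright Hleft].
set (g := fun y => T (hinge y)).
set (A := T (conv_affine 1 0)) in *. set (B := T (conv_affine 0 1)) in *.
assert (Lr : forall y, r < y -> locally y (fun z => g z = 0 + 0 * z)).
{ intros y Hy. generalize (locally_gt r y Hy). apply filter_imp. intros z Hz.
  unfold g. rewrite Hright by exact Hz. ring. }
assert (Ll : forall y, y < - r -> locally y (fun z => g z = B + (- A) * z)).
{ intros y Hy. generalize (locally_lt (- r) y Hy). apply filter_imp. intros z Hz.
  unfold g. rewrite Hleft by exact Hz. ring. }
assert (Ht : tails_affine g r).
{ intros y [Hy|Hy]; [exists B, (- A); apply Ll, Hy | exists 0, 0; apply Lr, Hy]. }
split; [exact Ht|].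
assert (Hg : forall y, continuous g y) by (intros; apply functional_hinge_continuous, HT).
assert (Hex : forall N, r < N -> exists h : Conv, (forall t, - N <= t <= N -> h t = f t) /\ T h = pairing g f N).
{ intros N HN.
  destruct (functional_affine_extension T f (- N) N Hf HT HA ltac:(lra)) as [h [Hh E]].
  exists h. split; [exact Hh|]. rewrite E. unfold pairing.
  rewrite (locally_singleton _ _ (loc_affine_Derive g N _ _ (Lr N HN))).
  rewrite (locally_singleton _ _ (loc_affine_Derive g (- N) _ _ (Ll (- N) ltac:(lra)))).
  rewrite (locally_singleton _ _ (Lr N HN)), (locally_singleton _ _ (Ll (- N) ltac:(lra))).
  fold A B. change (fun y => Derive_n f 2 y * T (hinge y)) with (fun y => Derive_n f 2 y * g y). ring. }
assert (HN : forall n, r < r + 1 + INR n) by (intros n; assert (H := pos_INR n); lra).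
set (h := fun n => proj1_sig (constructive_indefinite_description _ (Hex _ (HN n)))).
assert (Hh : forall n, (forall t, - (r + 1 + INR n) <= t <= r + 1 + INR n -> h n t = f t) /\
   T (h n) = pairing g f (r + 1 + INR n)).
{ intros n. exact (proj2_sig (constructive_indefinite_description _ (Hex _ (HN n)))). }
assert (L : is_lim_seq (fun n => T (h n)) (T f)).
{ apply HT. intros t. apply (is_lim_seq_ext_loc (fun _ => f t)); [|apply is_lim_seq_const].
  destruct (nfloor_ex (Rabs t) (Rabs_pos t)) as [N [_ HNt]].
  exists N. intros n Hn. apply le_INR in Hn. symmetry. apply Hh.
  apply Rabs_le_between. lra. }
apply (is_lim_seq_ext _ (fun _ => pairing g f (r + 1))) in L.
- apply is_lim_seq_unique in L. rewrite Lim_seq_const in L. injection L. auto.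
- intros n. rewrite (proj2 (Hh n)). symmetry. apply pairing_independent; auto.
  + assert (H := pos_INR n). lra.
  + intros y Hy. apply Ht. lra.
Qed.

(** Near [y], the Lipschitz constants in [x] are controlled by the values on three lines. *)
Lemma continuity_2d_of_convex (psi : R -> R -> R) x y :
  (forall y, convex_fun (fun x => psi x y)) -> (forall x, continuous (psi x) y) ->
  continuity_2d_pt psi x y.
Proof.
intros Hc Hy eps.
assert (He := cond_pos eps).
assert (Hl : forall x, forall e, 0 < e -> exists d, 0 < d /\ forall z, Rabs (z - y) < d -> Rabs (psi x z - psi x y) < e)
  by (intros z; apply (proj2 (continuous_eps (psi z) y) (Hy z))).
destruct (Hl x (Rmin 1 (eps / 2))) as [d0 [Hd0 H0]]; [apply Rmin_pos; lra|].
destruct (Hl (x + 1) 1) as [d1 [Hd1 H1]]; [lra|].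
destruct (Hl (x - 1) 1) as [d2 [Hd2 H2]]; [lra|].
set (L := Rabs (psi (x + 1) y - psi x y) + Rabs (psi (x - 1) y - psi x y) + 4).
assert (P1 := Rabs_pos (psi (x + 1) y - psi x y)). assert (P2 := Rabs_pos (psi (x - 1) y - psi x y)).
assert (HL : 0 < L) by (unfold L; lra).
set (d := Rmin (Rmin 1 (eps / (2 * L))) (Rmin d0 (Rmin d1 d2))).
assert (Hdl : 0 < eps / (2 * L)) by (apply Rdiv_lt_0_compat; lra).
assert (Hd : 0 < d) by (repeat apply Rmin_pos; lra).
assert (Hds : d <= 1 /\ d <= eps / (2 * L) /\ d <= d0 /\ d <= d1 /\ d <= d2).
{ assert (A1 := Rmin_l (Rmin 1 (eps / (2 * L))) (Rmin d0 (Rmin d1 d2))). fold d in A1.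
  assert (A2 := Rmin_r (Rmin 1 (eps / (2 * L))) (Rmin d0 (Rmin d1 d2))). fold d in A2.
  assert (A3 := Rmin_l 1 (eps / (2 * L))). assert (A4 := Rmin_r 1 (eps / (2 * L))).
  assert (A5 := Rmin_l d0 (Rmin d1 d2)). assert (A6 := Rmin_r d0 (Rmin d1 d2)).
  assert (A7 := Rmin_l d1 d2). assert (A8 := Rmin_r d1 d2). lra. }
exists (mkposreal d Hd). intros u v Hu Hv. simpl in Hu, Hv.
specialize (H0 v ltac:(lra)). specialize (H1 v ltac:(lra)). specialize (H2 v ltac:(lra)).
assert (Hlip := convex_local_lipschitz (fun x => psi x v) x (u - x) (Hc v) ltac:(lra)).
cbv beta in Hlip. replace (x + (u - x)) with u in Hlip by ring.
assert (M1 := Rmin_l 1 (eps / 2)). assert (M2 := Rmin_r 1 (eps / 2)).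
assert (Hs : Rabs (psi (x + 1) v - psi x v) + Rabs (psi (x - 1) v - psi x v) <= L).
{ assert (T1 : Rabs (psi (x + 1) v - psi x v) <= Rabs (psi (x + 1) y - psi x y) + 2).
  { replace (psi (x + 1) v - psi x v) with ((psi (x + 1) y - psi x y) + ((psi (x + 1) v - psi (x + 1) y) - (psi x v - psi x y))) by ring.
    eapply Rle_trans; [apply Rabs_triang|]. apply Rplus_le_compat_l.
    apply Rabs_def2 in H0. apply Rabs_def2 in H1. apply Rabs_le_between. lra. }
  assert (T2 : Rabs (psi (x - 1) v - psi x v) <= Rabs (psi (x - 1) y - psi x y) + 2).
  { replace (psi (x - 1) v - psi x v) with ((psi (x - 1) y - psi x y) + ((psi (x - 1) v - psi (x - 1) y) - (psi x v - psi x y))) by ring.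
    eapply Rle_trans; [apply Rabs_triang|]. apply Rplus_le_compat_l.
    apply Rabs_def2 in H0. apply Rabs_def2 in H2. apply Rabs_le_between. lra. }
  unfold L. lra. }
assert (Hb : Rabs (psi u v - psi x v) <= eps / 2).
{ eapply Rle_trans; [exact Hlip|].
  apply Rle_trans with (d * L).
  - apply Rmult_le_compat; [apply Rabs_pos | | lra | exact Hs].
    assert (Q1 := Rabs_pos (psi (x + 1) v - psi x v)). assert (Q2 := Rabs_pos (psi (x - 1) v - psi x v)). lra.
  - apply Rle_trans with (eps / (2 * L) * L); [apply Rmult_le_compat_r; lra|]. right. field. lra. }
replace (psi u v - psi x y) with ((psi u v - psi x v) + (psi x v - psi x y)) by ring.
eapply Rle_lt_trans; [apply Rabs_triang|]. lra.
Qed.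

Lemma compact_in_segment (A : R -> Prop) : compact A -> exists M, 0 < M /\ forall x, A x -> Rabs x <= M.
Proof.
intros HA. destruct (compact_P1 A HA) as [m [M H]].
exists (Rabs m + Rabs M + 1).
assert (H1 := Rle_abs M). assert (H2 := Rle_abs (- m)). rewrite Rabs_Ropp in H2.
assert (H3 := Rabs_pos M). assert (H4 := Rabs_pos m).
split; [lra|]. intros x Hx. specialize (H x Hx). apply Rabs_le_between. lra.
Qed.

(** The images of an affine function and of its opposite are convex and add up to zero. *)
Lemma image_affine (Psi : Conv -> Conv) c d x :
  (forall x, pointwise_continuous (fun f => Psi f x)) ->
  (forall x, additive_functional (fun f => Psi f x)) -> loc_affine (Psi (conv_affine c d)) x.
Proof.
intros HT HA. apply (loc_affine_of_three _ x 1); [lra|]. intros a m b _ Hm _.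
assert (Hopp : forall z, Psi (conv_affine (- c) (- d)) z = - Psi (conv_affine c d) z).
{ intros z. assert (E1 := functional_affine (fun f => Psi f z) c d (HT z) (HA z)).
  assert (E2 := functional_affine (fun f => Psi f z) (- c) (- d) (HT z) (HA z)). cbv beta in *. lra. }
assert (H1 := convex3 _ a m b (conv_fun_convex (Psi (conv_affine c d))) ltac:(lra)).
assert (H2 := convex3 _ a m b (conv_fun_convex (Psi (conv_affine (- c) (- d)))) ltac:(lra)).
rewrite !Hopp in H2. lra.
Qed.

(** The kernel is the Green function of the second derivative pushed through [Psi]: the
    image of the hinge with kink [y]. *)
Lemma representation_exists (Psi : Conv -> Conv) : epi_continuous Psi -> additive Psi ->
  exists psi, admissible psi /\ represents psi Psi.
Proof.
intros HC HAdd.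
assert (HT : forall x, pointwise_continuous (fun f => Psi f x)).
{ intros x fs f Hf. apply (proj1 (epi_continuous_pointwise Psi) HC fs f Hf x). }
assert (HA : forall x, additive_functional (fun f => Psi f x)) by (intros x g h; apply HAdd).
exists (fun x y => Psi (hinge y) x).
assert (Hcy : forall x y, continuous (fun y => Psi (hinge y) x) y).
{ intros x y. apply (functional_hinge_continuous (fun f => Psi f x)), HT. }
split; [split; [|split]|].
- intros x y. apply continuity_2d_of_convex; [intros z; apply conv_fun_convex | intros z; apply Hcy].
- intros y. apply conv_fun_convex.
- intros A HAc. destruct (compact_in_segment A HAc) as [M [HM Hsub]].
  destruct (locality Psi (M + 1) HT HA) as [r [Hr Hloc]].
  assert (Hh : forall x, Rabs x <= M + 1 -> (forall y, r < y -> Psi (hinge y) x = 0) /\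
     (forall y, y < - r -> Psi (hinge y) x = Psi (conv_affine 0 1) x - y * Psi (conv_affine 1 0) x)).
  { intros x Hx. apply (functional_hinge_tails (fun f => Psi f x) r (HT x) (HA x)).
    intros f Hf. apply Hloc; auto. }
  exists r. split; [exact Hr|]. split.
  + intros y Hy x Hx. apply loc_affine_outside_supp; [intros z; apply conv_continuous|].
    specialize (Hsub x Hx).
    assert (Hnear : locally x (fun z => Rabs z <= M + 1)).
    { exists (mkposreal 1 Rlt_0_1). intros z Hz. change (Rabs (z - x) < 1) in Hz.
      replace z with (x + (z - x)) by ring. eapply Rle_trans; [apply Rabs_triang | lra]. }
    destruct (Rlt_dec r y) as [Hgt|Hle].
    * exists 0, 0. revert Hnear. apply filter_imp. intros z Hz.
      rewrite (proj1 (Hh z Hz) y Hgt). Rring.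
    * destruct (image_affine Psi (- y) 1 x HT HA) as [c [d Hl]]. exists c, d.
      generalize (filter_and _ _ Hnear Hl). apply filter_imp. intros z [Hz <-].
      rewrite (proj2 (Hh z Hz) y ltac:(lra)).
      rewrite (functional_affine (fun f => Psi f z) (- y) 1 (HT z) (HA z)). Rring.
  + intros x Hx y Hy. specialize (Hsub x Hx).
    assert (Htail := functional_pairing (fun f => Psi f x) (conv_affine 0 0) r (HT x) (HA x) Hr).
    destruct Htail as [Htail _].
    { intros f Hf. apply Hloc; [exact Hf | lra]. }
    { apply (twice_C2 _ (fun _ => 0) (fun _ => 0)). apply (twice_ext _ _ _ _ _ _ (twice_const 0)); intros; simpl; ring. }
    exact (supp_of_tails _ r (Hcy x) Htail y Hy).
- intros f Hf x.
  destruct (locality Psi (Rabs x) HT HA) as [r [Hr Hloc]].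
  destruct (functional_pairing (fun f => Psi f x) f r (HT x) (HA x) Hr) as [Htail E]; [|exact Hf|].
  { intros g Hg. apply Hloc; [exact Hg | lra]. }
  cbv beta in E. rewrite E.
  apply (pairing_value _ f r); [apply Hcy | exact Hf | lra | exact Htail].
Qed.

(** * The map defined by an admissible kernel *)

(** Replacing [g] by its chord on $[u,v]$ makes the integral explicit after integration by
    parts, at the cost of the oscillation of [g] times the increase of the slope of [f]. *)
Lemma chord_step (f f1 f2 g : R -> R) (u v eps : R) : twice f f1 f2 -> (forall y, 0 <= f2 y) ->
  (forall y, continuous g y) -> u < v ->
  (forall s, u <= s <= v -> Rabs (g s - g u) <= eps /\ Rabs (g s - g v) <= eps) ->
  Rabs (RInt (fun y => f2 y * g y) u v - (f1 v * g v - f1 u * g u)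
        + (f v - f u) * (g v - g u) / (v - u)) <= eps * (f1 v - f1 u).
Proof.
intros Hf Hp Hg Huv Hosc.
set (k := (g v - g u) / (v - u)).
set (c := g u - k * u).
assert (Cl : forall y : R, continuous (fun y : R => c + k * y) y).
{ intros y. apply ex_derive_continuous_R. auto_derive. exact I. }
assert (Hparts := parts_loc_affine f f1 f2 (fun y => c + k * y) u v Hf Cl ltac:(lra)).
specialize (Hparts ltac:(intros y _; left; exists c, k; apply filter_forall; reflexivity)).
assert (Dl : forall y : R, Derive (fun y : R => c + k * y) y = k).
{ intros y. apply is_derive_unique. auto_derive; [exact I | ring]. }
cbv beta in Hparts. rewrite !Dl in Hparts.
replace (c + k * u) with (g u) in Hparts by (unfold c; ring).
replace (c + k * v) with (g v) in Hparts by (unfold c, k; field; lra).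
assert (Cg : forall y : R, continuous (fun y : R => f2 y * g y) y).
{ intros y. apply continuous_mult_R; [apply Hf | apply Hg]. }
assert (Cc : forall y : R, continuous (fun y : R => f2 y * (c + k * y)) y).
{ intros y. apply continuous_mult_R; [apply Hf | apply Cl]. }
assert (Hb : Rabs (RInt (fun y : R => 1 * (f2 y * g y) + (-1) * (f2 y * (c + k * y))) u v) <= RInt (fun y => eps * f2 y) u v).
{ apply RInt_abs_le; [lra| | |].
  - intros y. apply continuous_plus_R; (apply continuous_mult_R; [apply continuous_const|auto]).
  - intros y. apply continuous_mult_R; [apply continuous_const | apply Hf].
  - intros y Hy. destruct (Hosc y Hy) as [O1 O2].
    replace (1 * (f2 y * g y) + -1 * (f2 y * (c + k * y))) with (f2 y * (g y - (c + k * y))) by ring.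
    rewrite Rabs_mult, (Rabs_pos_eq (f2 y)), Rmult_comm by apply Hp.
    apply Rmult_le_compat_r; [apply Hp|].
    apply (Rmult_le_reg_l (v - u)); [lra|].
    rewrite <- (Rabs_pos_eq (v - u)) at 1 by lra. rewrite <- Rabs_mult.
    replace ((v - u) * (g y - (c + k * y))) with ((v - y) * (g y - g u) + (y - u) * (g y - g v))
      by (unfold c, k; field; lra).
    apply Rabs_le_between in O1. apply Rabs_le_between in O2. apply Rabs_le_between. split; nra. }
rewrite (RInt_lin _ _ _ _ _ _ Cg Cc), Hparts in Hb.
rewrite (RInt_fundamental (fun y => eps * f1 y) (fun y => eps * f2 y)) in Hb.
- replace (eps * (f1 v - f1 u)) with (eps * f1 v - eps * f1 u) by ring.
  eapply Rle_trans; [|exact Hb]. right. f_equal. unfold k. field. lra.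
- lra.
- intros y _. apply is_derive_scal, Hf.
- intros y. apply continuous_mult_R; [apply continuous_const | apply Hf].
Qed.

(** The integral of $f'g'$ with derivatives replaced by difference quotients. It involves [f]
    through finitely many values only, so it is continuous under pointwise limits. *)
Fixpoint dirichlet (g : R -> R) (a h : R) (n : nat) (f : R -> R) : R :=
  match n with
  | O => 0
  | S k => dirichlet g a h k f
      + (f (a + INR (S k) * h) - f (a + INR k * h)) * (g (a + INR (S k) * h) - g (a + INR k * h)) / h
  end.

Lemma dirichlet_approx (f f1 f2 g : R -> R) (a h eps : R) (n : nat) : twice f f1 f2 -> (forall y, 0 <= f2 y) ->
  (forall y, continuous g y) -> 0 < h ->
  (forall s t, a <= s <= a + INR n * h -> a <= t <= a + INR n * h -> Rabs (s - t) <= h ->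
     Rabs (g s - g t) <= eps) ->
  Rabs (RInt (fun y => f2 y * g y) a (a + INR n * h)
        - (f1 (a + INR n * h) * g (a + INR n * h) - f1 a * g a) + dirichlet g a h n f)
  <= eps * (f1 (a + INR n * h) - f1 a).
Proof.
intros Hf Hp Hg Hh. induction n as [|n IH]; intros Hosc.
- simpl INR. replace (a + 0 * h) with a by ring. rewrite RInt_point.
  change (zero : R) with 0. simpl dirichlet.
  rewrite Rabs_pos_eq; lra.
- assert (Hn := pos_INR n).
  cbn [dirichlet]. rewrite S_INR in *.
  set (u := a + INR n * h) in *. set (v := a + (INR n + 1) * h) in *.
  assert (Huv : v - u = h) by (unfold u, v; ring).
  assert (Hau : a <= u) by (unfold u; nra).
  assert (Cg : forall y : R, continuous (fun y : R => f2 y * g y) y).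
  { intros y. apply continuous_mult_R; [apply Hf | apply Hg]. }
  rewrite (RInt_split _ a u v Cg).
  assert (H1 := IH ltac:(intros; apply Hosc; lra)).
  assert (H2 := chord_step f f1 f2 g u v eps Hf Hp Hg ltac:(lra)).
  rewrite Huv in H2.
  specialize (H2 ltac:(intros s Hs; split; apply Hosc; try lra; apply Rabs_le_between; lra)).
  apply Rabs_le_between in H1. apply Rabs_le_between in H2. apply Rabs_le_between. lra.
Qed.

Lemma dirichlet_add g a h n f1 f2 :
  dirichlet g a h n (fun y => f1 y + f2 y) = dirichlet g a h n f1 + dirichlet g a h n f2.
Proof. induction n as [|n IH]; cbn [dirichlet]; [ring|]. rewrite IH. unfold Rdiv. ring. Qed.

Lemma dirichlet_lim g a h n (fs : nat -> R -> R) (f : R -> R) :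
  (forall y, is_lim_seq (fun k => fs k y) (f y)) ->
  is_lim_seq (fun k => dirichlet g a h n (fs k)) (dirichlet g a h n f).
Proof.
intros H. induction n as [|n IH]; cbn [dirichlet]; [apply is_lim_seq_const|].
apply is_lim_seq_plus'; [exact IH|]. unfold Rdiv.
apply is_lim_seq_mult'; [|apply is_lim_seq_const].
apply is_lim_seq_mult'; [|apply is_lim_seq_const].
apply is_lim_seq_minus'; apply H.
Qed.

(** For convex [f] this bounds $f'(M)-f'(-M)$ by values of [f], which pass to pointwise
    limits as slopes do not. *)
Definition slope_bound (M : R) (f : Conv) : R := (f (M + 1) - f M) + (f (- M - 1) - f (- M)).

Lemma slope_bound_correct M (f : Conv) : C2 f -> Derive f M - Derive f (- M) <= slope_bound M f.
Proof.
intros Hf. assert (Hd := twice_1 _ _ _ (C2_twice f Hf)).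
assert (H1 := convex_tangent f (Derive f) M (M + 1) (conv_fun_convex f) (Hd M)).
assert (H2 := convex_tangent f (Derive f) (- M) (- M - 1) (conv_fun_convex f) (Hd (- M))).
unfold slope_bound. lra.
Qed.

Lemma slope_bound_lim M : pointwise_continuous (slope_bound M).
Proof.
intros fs f H. unfold slope_bound.
apply is_lim_seq_plus'; apply is_lim_seq_minus'; apply H.
Qed.

Lemma uniform_continuity_segment (g : R -> R) (a b eps : R) : (forall y, continuous g y) -> 0 < eps ->
  exists d, 0 < d /\ forall s t, a <= s <= b -> a <= t <= b -> Rabs (s - t) < d -> Rabs (g s - g t) <= eps.
Proof.
intros Hg He.
destruct (Heine g (fun x => a <= x <= b) (compact_P3 a b)) with (eps := mkposreal eps He) as [d Hd].
- intros x _. apply continuity_pt_filterlim, Hg.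
- exists d. split; [apply cond_pos|]. intros s t Hs Ht Hst. left. exact (Hd s t Hs Ht Hst).
Qed.

(** The boundary slopes of [f] cancel between the pairing and the Dirichlet form, so that only
    values of [f] at finitely many points remain. *)
Lemma pairing_approx (g : R -> R) (M eps : R) : (forall y, continuous g y) -> 0 < M -> 0 < eps ->
  exists Phi : Conv -> R, pointwise_continuous Phi /\ additive_functional Phi /\
  forall f : Conv, C2 f -> Rabs (pairing g f M - Phi f) <= eps * slope_bound M f.
Proof.
intros Hg HM He.
destruct (uniform_continuity_segment g (- M) M eps Hg He) as [d [Hd Hosc]].
destruct (nfloor_ex (2 * M / d)) as [n [_ Hn]].
{ apply Rmult_le_pos; [lra | left; apply Rinv_0_lt_compat, Hd]. }
assert (Hnp : 0 < INR (S n)) by (rewrite S_INR; assert (H := pos_INR n); lra).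
set (h := 2 * M / INR (S n)).
assert (Hh : 0 < h) by (apply Rdiv_lt_0_compat; lra).
assert (Hhn : - M + INR (S n) * h = M) by (unfold h; field; lra).
assert (Hhd : h < d).
{ unfold h. apply (Rmult_lt_reg_r (INR (S n))); [exact Hnp|].
  unfold Rdiv. rewrite Rmult_assoc, Rinv_l, Rmult_1_r by lra.
  apply (Rmult_lt_compat_r d) in Hn; [|exact Hd].
  unfold Rdiv in Hn. rewrite Rmult_assoc, Rinv_l, Rmult_1_r in Hn by lra.
  rewrite S_INR. lra. }
exists (fun f => - dirichlet g (- M) h (S n) f + f M * Derive g M - f (- M) * Derive g (- M)).
split; [|split].
- intros fs f H. apply is_lim_seq_minus'; [apply is_lim_seq_plus'|].
  + apply (proj1 (is_lim_seq_opp (fun k => dirichlet g (- M) h (S n) (fs k)) (Finite _))).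
    apply dirichlet_lim, H.
  + apply is_lim_seq_mult'; [apply H | apply is_lim_seq_const].
  + apply is_lim_seq_mult'; [apply H | apply is_lim_seq_const].
- intros f1 f2. change (conv_fun (conv_add f1 f2)) with (fun y => f1 y + f2 y).
  rewrite dirichlet_add. ring.
- intros f Hf.
  assert (H := dirichlet_approx f _ _ g (- M) h eps (S n) (C2_twice f Hf) (C2_convex_nonneg f Hf) Hg Hh).
  rewrite Hhn in H. specialize (H ltac:(intros s t Hs Ht Hst; apply Hosc; lra)).
  unfold pairing.
  eapply Rle_trans; [|apply Rmult_le_compat_l; [left; exact He | apply slope_bound_correct, Hf]].
  eapply Rle_trans; [|exact H]. right. f_equal. ring.
Qed.

Lemma lim_seq_abs_le (u v : nat -> R) (a b : R) : is_lim_seq u a -> is_lim_seq v b ->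
  (forall n, Rabs (u n) <= v n) -> Rabs a <= b.
Proof.
intros Hu Hv H. apply is_lim_seq_abs in Hu.
exact (is_lim_seq_le (fun n => Rabs (u n)) v _ _ H Hu Hv).
Qed.

(** Functionals that are uniformly close on the dense set of $C^2$ functions stay close
    on all of [Conv]; so the approximating functionals are Cauchy everywhere, and their
    limit extends [P]. *)
Lemma extension (P V : Conv -> R) : pointwise_continuous V ->
  (forall eps, 0 < eps -> exists Phi, pointwise_continuous Phi /\ additive_functional Phi /\
     forall f : Conv, C2 f -> Rabs (P f - Phi f) <= eps * V f) ->
  exists T, pointwise_continuous T /\ additive_functional T /\ forall f : Conv, C2 f -> T f = P f.
Proof.
intros HV H.
set (Phi := fun n => proj1_sig (constructive_indefinite_description _ (H _ (unit_frac_pos n)))).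
assert (HPhi : forall n, pointwise_continuous (Phi n) /\ additive_functional (Phi n) /\
   forall f : Conv, C2 f -> Rabs (P f - Phi n f) <= unit_frac n * V f).
{ intros n. exact (proj2_sig (constructive_indefinite_description _ (H _ (unit_frac_pos n)))). }
assert (Hclose : forall n m f, Rabs (Phi n f - Phi m f) <= (unit_frac n + unit_frac m) * V f).
{ intros n m f.
  apply (lim_seq_abs_le (fun k => Phi n (mollify k f) - Phi m (mollify k f))
      (fun k => (unit_frac n + unit_frac m) * V (mollify k f))).
  - apply is_lim_seq_minus'; apply HPhi; apply mollify_lim.
  - apply is_lim_seq_mult'; [apply is_lim_seq_const|]. apply HV, mollify_lim.
  - intros k. destruct (HPhi n) as [_ [_ Hn]]. destruct (HPhi m) as [_ [_ Hm]].
    specialize (Hn _ (mollify_C2 k f)). specialize (Hm _ (mollify_C2 k f)).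
    apply Rabs_le_between in Hn. apply Rabs_le_between in Hm. apply Rabs_le_between. lra. }
assert (Hlim : forall f, is_lim_seq (fun n => Phi n f) (real (Lim_seq (fun n => Phi n f)))).
{ intros f. apply Lim_seq_correct'. apply ex_lim_seq_cauchy_corr. intros eps.
  assert (He := cond_pos eps). assert (HVp := Rabs_pos (V f)).
  assert (Hq : 0 < eps / (2 * (Rabs (V f) + 1))) by (apply Rdiv_lt_0_compat; lra).
  destruct (proj2 (is_lim_seq_eps unit_frac 0) unit_frac_lim _ Hq) as [N HN].
  exists N. intros n m Hn Hm.
  eapply Rle_lt_trans; [apply Hclose|].
  assert (A1 := HN n Hn). assert (A2 := HN m Hm). cbv beta in A1, A2.
  rewrite Rminus_0_r, Rabs_pos_eq in A1, A2 by (left; apply unit_frac_pos).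
  assert (U1 := unit_frac_pos n). assert (U2 := unit_frac_pos m).
  apply Rle_lt_trans with ((unit_frac n + unit_frac m) * (Rabs (V f) + 1)).
  - apply Rmult_le_compat_l; [lra|]. assert (A3 := Rle_abs (V f)). lra.
  - replace (pos eps) with ((eps / (2 * (Rabs (V f) + 1)) + eps / (2 * (Rabs (V f) + 1))) * (Rabs (V f) + 1)) by (field; lra).
    apply Rmult_lt_compat_r; lra. }
set (T := fun f => real (Lim_seq (fun n => Phi n f))) in *.
assert (HT : forall n f, Rabs (T f - Phi n f) <= unit_frac n * V f).
{ intros n f. replace (unit_frac n * V f) with ((0 + unit_frac n) * V f) by ring.
  apply (lim_seq_abs_le (fun m => Phi m f - Phi n f) (fun m => (unit_frac m + unit_frac n) * V f)).
  - apply is_lim_seq_minus'; [apply Hlim | apply is_lim_seq_const].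
  - apply is_lim_seq_mult'; [|apply is_lim_seq_const].
    apply is_lim_seq_plus'; [apply unit_frac_lim | apply is_lim_seq_const].
  - intros m. apply Hclose. }
exists T. split; [|split].
- intros fs f Hfs. apply is_lim_seq_eps. intros eps He.
  assert (HVp := Rabs_pos (V f)).
  assert (Hq : 0 < eps / (4 * (Rabs (V f) + 1))) by (apply Rdiv_lt_0_compat; lra).
  destruct (proj2 (is_lim_seq_eps unit_frac 0) unit_frac_lim _ Hq) as [N HN].
  specialize (HN N (le_n N)). rewrite Rminus_0_r, Rabs_pos_eq in HN by (left; apply unit_frac_pos).
  assert (U := unit_frac_pos N).
  assert (Hc1 := proj2 (is_lim_seq_eps _ _) (HV fs f Hfs) 1 Rlt_0_1).
  assert (Hc2 := proj2 (is_lim_seq_eps _ _) (proj1 (HPhi N) fs f Hfs) (eps / 4) ltac:(lra)).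
  generalize (filter_and _ _ Hc1 Hc2). apply filter_imp. intros k [K1 K2].
  assert (B : unit_frac N * (Rabs (V f) + 1) < eps / 4).
  { replace (eps / 4) with (eps / (4 * (Rabs (V f) + 1)) * (Rabs (V f) + 1)) by (field; lra).
    apply Rmult_lt_compat_r; lra. }
  assert (T1 := HT N (fs k)). assert (T2 := HT N f).
  assert (A3 := Rle_abs (V f)).
  apply Rabs_def2 in K1. apply Rabs_def2 in K2.
  assert (B1 : unit_frac N * V f <= unit_frac N * (Rabs (V f) + 1)) by (apply Rmult_le_compat_l; lra).
  assert (B2 : unit_frac N * V (fs k) <= unit_frac N * (Rabs (V f) + 1)) by (apply Rmult_le_compat_l; lra).
  apply Rabs_le_between in T1. apply Rabs_le_between in T2. apply Rabs_def1; lra.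
- intros f g.
  assert (L : is_lim_seq (fun n => Phi n (conv_add f g)) (T f + T g)).
  { apply (is_lim_seq_ext (fun n => Phi n f + Phi n g)).
    - intros n. symmetry. apply HPhi.
    - apply is_lim_seq_plus'; apply Hlim. }
  unfold T at 1. rewrite (is_lim_seq_unique _ _ L). reflexivity.
- intros f Hf.
  assert (L : is_lim_seq (fun n => Phi n f) (P f)).
  { apply is_lim_seq_eps. intros eps He.
    assert (HVp := Rabs_pos (V f)).
    assert (Hq : 0 < eps / (Rabs (V f) + 1)) by (apply Rdiv_lt_0_compat; lra).
    generalize (proj2 (is_lim_seq_eps unit_frac 0) unit_frac_lim _ Hq). apply filter_imp.
    intros n Hn. rewrite Rminus_0_r, Rabs_pos_eq in Hn by (left; apply unit_frac_pos).
    assert (U := unit_frac_pos n). assert (A3 := Rle_abs (V f)).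
    rewrite Rabs_minus_sym. eapply Rle_lt_trans; [apply HPhi, Hf|].
    apply Rle_lt_trans with (unit_frac n * (Rabs (V f) + 1)); [apply Rmult_le_compat_l; lra|].
    replace eps with (eps / (Rabs (V f) + 1) * (Rabs (V f) + 1)) by (field; lra).
    apply Rmult_lt_compat_r; lra. }
  unfold T. rewrite (is_lim_seq_unique _ _ L). reflexivity.
Qed.

Lemma kernel_functional g r : (forall y, continuous g y) -> 0 < r -> tails_affine g r ->
  exists T, pointwise_continuous T /\ additive_functional T /\
    forall f : Conv, C2 f -> dist_d2_value g f (T f).
Proof.
intros Hg Hr Ht.
destruct (extension (fun f => pairing g f (r + 1)) (slope_bound (r + 1)) (slope_bound_lim _))
  as [T [H1 [H2 H3]]].
- intros eps He. apply pairing_approx; [exact Hg | lra | exact He].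
- exists T. split; [exact H1|]. split; [exact H2|]. intros f Hf. rewrite H3 by exact Hf.
  apply (pairing_value g f r); [exact Hg | exact Hf | lra | exact Ht].
Qed.

Lemma admissible_continuous_y psi x y : admissible psi -> continuous (psi x) y.
Proof.
intros [H _]. apply continuous_eps. intros eps He.
destruct (H x y (mkposreal eps He)) as [d Hd].
exists d. split; [apply cond_pos|]. intros z Hz. apply Hd; [|exact Hz].
unfold Rminus. rewrite Rplus_opp_r, Rabs_R0. apply cond_pos.
Qed.

Lemma admissible_tails psi a b : admissible psi -> exists r, 0 < r /\
  forall x, a <= x <= b -> tails_affine (psi x) r /\
    forall y, y < - r \/ r < y -> loc_affine (fun z => psi z y) x.
Proof.
intros Hadm. assert (Hy := fun x y => admissible_continuous_y psi x y Hadm).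
destruct Hadm as [_ [Hconv Hsupp]].
destruct (Hsupp (fun x => a <= x <= b) (compact_P3 a b)) as [r [Hr [H1 H2]]].
exists r. split; [exact Hr|]. intros x Hx. split; intros y Hyr; apply loc_affine_of_not_supp.
- intros z. apply Hy.
- intros Hs. specialize (H2 x Hx y Hs). lra.
- intros z. apply (convex_continuous (fun x => psi x y)), Hconv.
- apply H1; [lra | exact Hx].
Qed.

Lemma affine_three_points (h : R -> R) (a m b : R) : (forall y, continuous h y) -> a < m < b ->
  (forall y, a <= y <= b -> loc_affine h y) -> (b - a) * h m = (b - m) * h a + (m - a) * h b.
Proof.
intros Hh Hm H.
destruct (loc_affine_segment h a m Hh) as [E1 E2]; [lra | intros; apply H; lra|].
destruct (loc_affine_segment h m b Hh) as [E3 E4]; [lra | intros; apply H; lra|].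
replace (h b) with (h m + (b - m) * Derive h b) by lra.
replace (h a) with (h m - (m - a) * Derive h m) by lra.
rewrite E3. ring.
Qed.

(** The integral is convex in [x] because $f''\ge0$; the boundary terms are affine in [x],
    because they involve only values of [psi] at parameters [y] where it is affine in [x]. *)
Lemma pairing_convex psi (f : Conv) a m b : admissible psi -> C2 f -> a < m < b ->
  exists M, (forall x, a <= x <= b -> dist_d2_value (psi x) f (pairing (psi x) f M)) /\
    (b - a) * pairing (psi m) f M <= (b - m) * pairing (psi a) f M + (m - a) * pairing (psi b) f M.
Proof.
intros Hadm Hf Hm.
destruct (admissible_tails psi a b Hadm) as [r [Hr Ht]].
assert (Hy := fun x y => admissible_continuous_y psi x y Hadm).
destruct Hadm as [_ [Hconv _]].
assert (Hx : forall y x, continuous (fun z => psi z y) x).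
{ intros y x. apply (convex_continuous (fun x => psi x y)), Hconv. }
set (M := r + 1). exists M. split.
{ intros x Hxab. apply (pairing_value _ f r); [apply Hy | exact Hf | unfold M; lra | apply Ht, Hxab]. }
assert (Dr : forall x, a <= x <= b -> Derive (psi x) M = psi x (M + 1) - psi x M).
{ intros x Hxab. destruct (loc_affine_segment (psi x) M (M + 1) (Hy x)) as [E1 E2]; [lra| |lra].
  intros y Hyy. apply (proj1 (Ht x Hxab)). unfold M in Hyy. lra. }
assert (Dl : forall x, a <= x <= b -> Derive (psi x) (- M) = psi x (- M) - psi x (- M - 1)).
{ intros x Hxab. destruct (loc_affine_segment (psi x) (- M - 1) (- M) (Hy x)) as [E1 E2]; [lra| |lra].
  intros y Hyy. apply (proj1 (Ht x Hxab)). unfold M in Hyy. lra. }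
assert (Haff : forall y, y < - r \/ r < y -> (b - a) * psi m y = (b - m) * psi a y + (m - a) * psi b y).
{ intros y Hyr. apply (affine_three_points (fun z => psi z y)); [apply Hx | exact Hm|].
  intros x Hxab. apply (proj2 (Ht x Hxab)), Hyr. }
assert (A1 := Haff M ltac:(unfold M; lra)). assert (A2 := Haff (M + 1) ltac:(unfold M; lra)).
assert (A3 := Haff (- M) ltac:(unfold M; lra)). assert (A4 := Haff (- M - 1) ltac:(unfold M; lra)).
unfold pairing. rewrite !Dr, !Dl by lra.
assert (Cx : forall x (y : R), continuous (fun y : R => Derive_n f 2 y * psi x y) y).
{ intros x y. apply continuous_mult_R; [apply (C2_twice f Hf) | apply Hy]. }
assert (HI : (b - a) * RInt (fun y => Derive_n f 2 y * psi m y) (- M) M <=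
  (b - m) * RInt (fun y => Derive_n f 2 y * psi a y) (- M) M + (m - a) * RInt (fun y => Derive_n f 2 y * psi b y) (- M) M).
{ rewrite <- (RInt_lin _ _ _ _ _ _ (Cx a) (Cx b)).
  replace ((b - a) * RInt (fun y => Derive_n f 2 y * psi m y) (- M) M)
    with ((b - a) * RInt (fun y => Derive_n f 2 y * psi m y) (- M) M + 0 * RInt (fun y => Derive_n f 2 y * psi m y) (- M) M) by ring.
  rewrite <- (RInt_lin _ _ _ _ _ _ (Cx m) (Cx m)).
  apply RInt_le; [unfold M; lra| | |].
  - apply ex_RInt_cont. intros y. apply continuous_plus_R; (apply continuous_mult_R; [apply continuous_const | apply Cx]).
  - apply ex_RInt_cont. intros y. apply continuous_plus_R; (apply continuous_mult_R; [apply continuous_const | apply Cx]).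
  - intros y _. assert (H := convex3 _ a m b (Hconv y) ltac:(lra)). cbv beta in H.
    assert (H0 := C2_convex_nonneg f Hf y). nra. }
set (Im := RInt (fun y => Derive_n f 2 y * psi m y) (- M) M : R) in *.
set (Ia := RInt (fun y => Derive_n f 2 y * psi a y) (- M) M : R) in *.
set (Ib := RInt (fun y => Derive_n f 2 y * psi b y) (- M) M : R) in *.
set (p := Derive f M). set (q := Derive f (- M)).
apply (f_equal (Rmult p)) in A1 as B1. apply (f_equal (Rmult (f M))) in A1.
apply (f_equal (Rmult (f M))) in A2.
apply (f_equal (Rmult q)) in A3 as B3. apply (f_equal (Rmult (f (- M)))) in A3.
apply (f_equal (Rmult (f (- M)))) in A4.
lra.
Qed.

Lemma functional_eq_of_C2 (T1 T2 : Conv -> R) : pointwise_continuous T1 -> pointwise_continuous T2 ->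
  (forall f : Conv, C2 f -> T1 f = T2 f) -> forall f, T1 f = T2 f.
Proof.
intros H1 H2 E f.
assert (L1 := H1 (fun n => mollify n f) f (mollify_lim f)).
assert (L2 := H2 (fun n => mollify n f) f (mollify_lim f)).
apply (is_lim_seq_ext _ (fun n => T2 (mollify n f))) in L1; [|intros n; apply E, mollify_C2].
apply is_lim_seq_unique in L1. apply is_lim_seq_unique in L2. rewrite L1 in L2. injection L2. auto.
Qed.

(** At each point [x] the functional is extended from $C^2$ functions separately; convexity
    in [x] is then inherited from the mollified functions. *)
Lemma operator_exists psi : admissible psi ->
  exists Psi : Conv -> Conv, (epi_continuous Psi /\ additive Psi) /\ represents psi Psi.
Proof.
intros Hadm.
assert (Hex : forall x, exists T, pointwise_continuous T /\ additive_functional T /\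
    forall f : Conv, C2 f -> dist_d2_value (psi x) f (T f)).
{ intros x. destruct (admissible_tails psi x x Hadm) as [r [Hr Ht]].
  apply (kernel_functional (psi x) r); [intros y; apply admissible_continuous_y, Hadm | exact Hr|].
  apply Ht. lra. }
set (T := fun x => proj1_sig (constructive_indefinite_description _ (Hex x))).
assert (HT : forall x, pointwise_continuous (T x) /\ additive_functional (T x) /\
    forall f : Conv, C2 f -> dist_d2_value (psi x) f (T x f)).
{ intros x. exact (proj2_sig (constructive_indefinite_description _ (Hex x))). }
assert (Hconv : forall f, convex_fun (fun x => T x f)).
{ intros f. apply convex3_intro. intros a m b Hm.
  apply (is_lim_seq_le (fun n => (b - a) * T m (mollify n f))
    (fun n => (b - m) * T a (mollify n f) + (m - a) * T b (mollify n f))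
    (Finite ((b - a) * T m f)) (Finite ((b - m) * T a f + (m - a) * T b f))).
  - intros n. destruct (pairing_convex psi (mollify n f) a m b Hadm (mollify_C2 n f) Hm) as [M [Hv Hle]].
    assert (E : forall x, a <= x <= b -> T x (mollify n f) = pairing (psi x) (mollify n f) M).
    { intros x Hx. apply (dist_d2_value_unique (psi x) (mollify n f)); [apply HT, mollify_C2 | apply Hv, Hx]. }
    rewrite !E by lra. exact Hle.
  - apply is_lim_seq_mult'; [apply is_lim_seq_const | apply HT, mollify_lim].
  - apply is_lim_seq_plus'; (apply is_lim_seq_mult'; [apply is_lim_seq_const | apply HT, mollify_lim]). }
exists (fun f => mkConv (fun x => T x f) (Hconv f)). split; [split|].
- apply epi_continuous_pointwise. intros fs f Hf x. apply (proj1 (HT x)), Hf.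
- intros g h x. exact (proj1 (proj2 (HT x)) g h).
- intros f Hf x. exact (proj2 (proj2 (HT x)) f Hf).
Qed.

Lemma epi_continuous_functional Psi x : epi_continuous Psi -> pointwise_continuous (fun f => Psi f x).
Proof. intros H fs f Hf. apply (proj1 (epi_continuous_pointwise Psi) H fs f Hf x). Qed.

Lemma operator_unique psi Psi Psi' : epi_continuous Psi -> represents psi Psi ->
  epi_continuous Psi' -> represents psi Psi' -> forall (f : Conv) x, Psi' f x = Psi f x.
Proof.
intros HC HR HC' HR' f x. revert f.
apply (functional_eq_of_C2 (fun f => Psi' f x) (fun f => Psi f x));
  [apply epi_continuous_functional, HC' | apply epi_continuous_functional, HC|].
intros f Hf. apply (dist_d2_value_unique (psi x) f); [apply HR', Hf | apply HR, Hf].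
Qed.

(** * Monotone maps *)

Lemma RInt_parts_twice u u1 u2 v v1 v2 a b : twice u u1 u2 -> twice v v1 v2 -> a <= b ->
  u a = 0 -> u1 a = 0 -> u b = 0 -> u1 b = 0 ->
  RInt (fun y => u2 y * v y) a b = RInt (fun y => u y * v2 y) a b.
Proof.
intros Hu Hv Hab E1 E2 E3 E4.
assert (C1 : forall y : R, continuous (fun y : R => u2 y * v y) y).
{ intros y. apply continuous_mult_R; [apply Hu | apply (twice_continuous _ _ _ y Hv)]. }
assert (C2' : forall y : R, continuous (fun y : R => u y * v2 y) y).
{ intros y. apply continuous_mult_R; [apply (twice_continuous _ _ _ y Hu) | apply Hv]. }
assert (H : RInt (fun y => 1 * (u2 y * v y) + (-1) * (u y * v2 y)) a b = 0).
{ rewrite (RInt_fundamental (fun y => u1 y * v y - u y * v1 y)); [rewrite E1, E2, E3, E4; Rring | exact Hab | |].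
  - intros y _.
    replace (1 * (u2 y * v y) + -1 * (u y * v2 y)) with ((u2 y * v y + u1 y * v1 y) - (u1 y * v1 y + u y * v2 y)) by ring.
    apply (is_derive_minus (fun y => u1 y * v y) (fun y => u y * v1 y)).
    + apply (is_derive_mult u1 v); [apply Hu | apply Hv | intros; apply Rmult_comm].
    + apply (is_derive_mult u v1); [apply Hu | apply Hv | intros; apply Rmult_comm].
  - intros y. apply continuous_plus_R; (apply continuous_mult_R; [apply continuous_const | auto]). }
rewrite (RInt_lin _ _ _ _ _ _ C1 C2') in H. lra.
Qed.

(** For a smoothing of [g] this follows by integrating by parts twice, because its second
    derivative is nonnegative; the smoothings converge uniformly on the support of [u]. *)
Lemma dist_d2_nonneg g u u1 u2 L : convex_fun g -> twice u u1 u2 -> 0 < L ->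
  (forall y, y < - L \/ L < y -> u y = 0) -> (forall y, 0 <= u y) -> 0 <= dist_d2 g u.
Proof.
intros Hc Hu HL Hz Hp.
assert (Hg : forall y, continuous g y) by (intros; apply convex_continuous, Hc).
set (N := L + 1).
rewrite (dist_d2_RInt g u u1 u2 L (- N) N Hu Hg HL Hz) by (unfold N; lra).
assert (Cu : forall y : R, continuous (fun y : R => Rabs (u2 y)) y).
{ intros y. apply (continuous_comp u2 Rabs); [apply Hu | apply continuous_Rabs]. }
assert (Cg : forall y : R, continuous (fun y : R => u2 y * g y) y).
{ intros y. apply continuous_mult_R; [apply Hu | apply Hg]. }
set (C := RInt (fun y => Rabs (u2 y)) (- N) N : R).
assert (HC : 0 <= C).
{ apply RInt_ge_0; [unfold N; lra | apply ex_RInt_cont, Cu | intros; apply Rabs_pos]. }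
assert (Heps : forall eps, 0 < eps -> - eps * C <= RInt (fun y => u2 y * g y) (- N) N).
{ intros eps He.
  destruct (uniform_continuity_segment g (- N - 1) (N + 1) eps Hg He) as [d [Hd Hosc]].
  set (h := Rmin 1 (d / 2)).
  assert (Hh : 0 < h) by (apply Rmin_pos; lra).
  assert (Hh1 := Rmin_l 1 (d / 2)). assert (Hh2 := Rmin_r 1 (d / 2)). fold h in Hh1, Hh2.
  destruct (tent_average_twice g h Hg Hh) as [v1 Hv].
  set (v2 := fun y => (g (y + h) - 2 * g y + g (y - h)) / h ^ 2) in *.
  assert (Hv2 : forall y, 0 <= v2 y).
  { intros y. apply (convex_twice_nonneg (tent_average h g) v1 v2 y); [|exact Hv].
    apply tent_average_convex; [exact Hc | exact Hh]. }
  assert (Ha : u (- N) = 0 /\ u1 (- N) = 0 /\ u2 (- N) = 0).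
  { apply (twice_locally_zero u u1 u2); [exact Hu|].
    generalize (locally_out L (- N) ltac:(unfold N; lra)). apply filter_imp, Hz. }
  assert (Hb : u N = 0 /\ u1 N = 0 /\ u2 N = 0).
  { apply (twice_locally_zero u u1 u2); [exact Hu|].
    generalize (locally_out L N ltac:(unfold N; lra)). apply filter_imp, Hz. }
  assert (Ct : forall y : R, continuous (fun y : R => u2 y * tent_average h g y) y).
  { intros y. apply continuous_mult_R; [apply Hu | apply (twice_continuous _ _ _ y Hv)]. }
  assert (Hpos : 0 <= RInt (fun y => u2 y * tent_average h g y) (- N) N).
  { rewrite (RInt_parts_twice u u1 u2 _ v1 v2 (- N) N Hu Hv); try tauto; [|unfold N; lra].
    apply RInt_ge_0; [unfold N; lra | |].
    - apply ex_RInt_cont. intros y. apply continuous_mult_R; [apply (twice_continuous _ _ _ y Hu) | apply Hv].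
    - intros y _. apply Rmult_le_pos; auto. }
  assert (Hdiff : Rabs (RInt (fun y => 1 * (u2 y * tent_average h g y) + (-1) * (u2 y * g y)) (- N) N)
     <= RInt (fun y => eps * Rabs (u2 y)) (- N) N).
  { apply RInt_abs_le; [unfold N; lra| | |].
    - intros y. apply continuous_plus_R; (apply continuous_mult_R; [apply continuous_const | auto]).
    - intros y. apply continuous_mult_R; [apply continuous_const | apply Cu].
    - intros y Hy. replace (1 * (u2 y * tent_average h g y) + -1 * (u2 y * g y))
        with (u2 y * (tent_average h g y - g y)) by ring.
      rewrite Rabs_mult, Rmult_comm. apply Rmult_le_compat_r; [apply Rabs_pos|].
      apply tent_average_close; [exact Hg | exact Hh|].
      intros t Ht. split; apply Hosc; try lra; apply Rabs_def1; lra. }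
  rewrite (RInt_lin _ _ _ _ _ _ Ct Cg) in Hdiff.
  replace (RInt (fun y => eps * Rabs (u2 y)) (- N) N) with (eps * C) in Hdiff.
  - apply Rabs_le_between in Hdiff. lra.
  - unfold C. symmetry. apply (RInt_scal (fun y => Rabs (u2 y)) (- N) N eps), ex_RInt_cont, Cu. }
apply Rnot_lt_le. intros Hneg.
set (I0 := RInt (fun y => u2 y * g y) (- N) N : R) in *.
assert (Hq : 0 < - I0 / (2 * (C + 1))) by (apply Rdiv_lt_0_compat; lra).
specialize (Heps _ Hq).
assert (E : - I0 / (2 * (C + 1)) * (C + 1) = - I0 / 2) by (field; lra).
assert (- I0 / (2 * (C + 1)) * C <= - I0 / 2) by nra. lra.
Qed.

Lemma dist_d2_lin g u u1 u2 v v1 v2 c d L : twice u u1 u2 -> twice v v1 v2 ->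
  (forall y, continuous g y) -> 0 < L ->
  (forall y, y < - L \/ L < y -> u y = 0) -> (forall y, y < - L \/ L < y -> v y = 0) ->
  dist_d2 g (fun y => c * u y + d * v y) = c * dist_d2 g u + d * dist_d2 g v.
Proof.
intros Hu Hv Hg HL Zu Zv.
rewrite (dist_d2_RInt g _ _ _ L (- L) L (twice_lin _ _ _ _ _ _ c d Hu Hv) Hg HL); [| |lra|lra].
2:{ intros y Hy. rewrite Zu, Zv by exact Hy. ring. }
rewrite (dist_d2_RInt g u u1 u2 L (- L) L Hu Hg HL Zu) by lra.
rewrite (dist_d2_RInt g v v1 v2 L (- L) L Hv Hg HL Zv) by lra.
rewrite <- RInt_lin.
- apply RInt_ext. intros y _. Rring.
- intros y. apply continuous_mult_R; [apply Hu | apply Hg].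
- intros y. apply continuous_mult_R; [apply Hv | apply Hg].
Qed.

(** The same cutoff function serves for both values; being nonnegative, it preserves the sign
    of $f_2-f_1$. *)
Lemma represented_difference g (f1 f2 : R -> R) r v1 v2 : (forall y, continuous g y) -> 0 < r ->
  tails_affine g r -> C2 f1 -> C2 f2 -> dist_d2_value g f1 v1 -> dist_d2_value g f2 v2 ->
  v2 - v1 = dist_d2 g (fun y => plateau r y * (f2 y - f1 y)).
Proof.
intros Hg Hr Ht H1 H2 [_ V1] [_ V2].
assert (Hcut := plateau_cutoff _ r (supp_of_tails g r Hg Ht)).
rewrite (V1 _ Hcut), (V2 _ Hcut).
assert (Hpl := smooth_twice _ (plateau_smooth r)).
assert (T1 := twice_mult _ _ _ _ _ _ Hpl (C2_twice f1 H1)).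
assert (T2 := twice_mult _ _ _ _ _ _ Hpl (C2_twice f2 H2)).
replace (fun y => plateau r y * (f2 y - f1 y)) with (fun y => 1 * (plateau r y * f2 y) + -1 * (plateau r y * f1 y))
  by (apply functional_extensionality; intros y; ring).
rewrite (dist_d2_lin g _ _ _ _ _ _ 1 (-1) (r + 2) T2 T1 Hg); [ring | lra | |];
  intros y Hy; rewrite plateau_out by exact Hy; ring.
Qed.

Lemma monotone_of_convex Psi psi : epi_continuous Psi -> admissible psi -> represents psi Psi ->
  (forall x, convex_fun (psi x)) -> monotone Psi.
Proof.
intros HC Hadm HR Hconv f g Hfg x.
assert (HT := epi_continuous_functional Psi x HC).
apply (is_lim_seq_le (fun n => Psi (mollify n f) x) (fun n => Psi (mollify n g) x) (Finite (Psi f x)) (Finite (Psi g x))).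
2: exact (HT _ f (mollify_lim f)).
2: exact (HT _ g (mollify_lim g)).
intros n.
destruct (admissible_tails psi x x Hadm) as [r [Hr Ht]].
destruct (Ht x ltac:(lra)) as [Htail _].
assert (Hg := fun y => admissible_continuous_y psi x y Hadm).
assert (Hf1 := mollify_C2 n f). assert (Hf2 := mollify_C2 n g).
assert (D := represented_difference (psi x) (mollify n f) (mollify n g) r _ _ Hg Hr Htail Hf1 Hf2
   (HR _ Hf1 x) (HR _ Hf2 x)).
enough (0 <= Psi (mollify n g) x - Psi (mollify n f) x) by lra.
rewrite D.
assert (T := twice_mult _ _ _ _ _ _ (smooth_twice _ (plateau_smooth r))
  (twice_lin _ _ _ _ _ _ 1 (-1) (C2_twice _ Hf2) (C2_twice _ Hf1))).
replace (fun y => plateau r y * (mollify n g y - mollify n f y))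
  with (fun y => plateau r y * (1 * mollify n g y + -1 * mollify n f y))
  by (apply functional_extensionality; intros y; ring).
apply (dist_d2_nonneg _ _ _ _ (r + 2) (Hconv x) T); [lra| |].
- intros y Hy. rewrite plateau_out by exact Hy. ring.
- intros y. apply Rmult_le_pos; [apply plateau_nonneg|].
  assert (H := mollify_le n f g Hfg y). lra.
Qed.

Definition conv_ramp (a e : R) (He : 0 < e) : Conv := mkConv (ramp_at a e) (ramp_at_convex a e He).

(** A smoothed hat is the difference of two ordered convex functions, so a monotone map
    gives it a nonnegative value; in the limit this value is a second difference of [psi x]. *)
Lemma convex_of_monotone Psi psi : admissible psi -> represents psi Psi ->
  monotone Psi -> forall x, convex_fun (psi x).
Proof.
intros Hadm HR Hmono x. apply convex3_intro. intros a m b Hm.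
destruct (admissible_tails psi x x Hadm) as [r0 [Hr0 Ht]].
destruct (Ht x ltac:(lra)) as [Htail0 _].
assert (Hg := fun y => admissible_continuous_y psi x y Hadm).
set (r := r0 + Rabs a + Rabs b + 1).
assert (B1 := Rle_abs b). assert (B2 := Rle_abs (- a)). rewrite Rabs_Ropp in B2.
assert (B3 := Rabs_pos a). assert (B4 := Rabs_pos b).
assert (Htail : tails_affine (psi x) r) by (intros y Hy; apply Htail0; unfold r in Hy; lra).
apply Rnot_lt_le. intros Hlt.
set (v := (b - m) * psi x a - (b - a) * psi x m + (m - a) * psi x b).
assert (Hv : v < 0) by (unfold v; lra).
destruct (dist_hat_limit (psi x) a m b Hg Hm (- v / 2) ltac:(lra)) as [e0 [He0 Hl]].
set (e := Rmin (e0 / 2) 1).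
assert (He : 0 < e) by (apply Rmin_pos; lra).
assert (He1 := Rmin_l (e0 / 2) 1). assert (He2 := Rmin_r (e0 / 2) 1). fold e in He1, He2.
specialize (Hl e ltac:(lra)). fold v in Hl. apply Rabs_le_between in Hl.
assert (H1 : 0 <= b - m) by lra. assert (H2 : 0 <= m - a) by lra. assert (H3 : 0 <= b - a) by lra.
set (F := conv_add (conv_scal _ H1 (conv_ramp a e He)) (conv_scal _ H2 (conv_ramp b e He))).
set (G := conv_scal _ H3 (conv_ramp m e He)).
assert (EH : forall y, F y - G y = hat a m b e y) by (intros y; unfold hat; simpl; ring).
assert (HF : C2 F).
{ exact (twice_C2 _ _ _ (twice_lin _ _ _ _ _ _ (b - m) (m - a) (ramp_at_twice a e He) (ramp_at_twice b e He))). }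
assert (HG : C2 G).
{ eapply twice_C2.
  apply (twice_ext _ _ _ _ _ _ (twice_lin _ _ _ _ _ _ (b - a) 0 (ramp_at_twice m e He) (twice_const 0)));
    [|reflexivity|reflexivity].
  intros y. simpl. ring. }
assert (HGF := Hmono G F ltac:(intros y; assert (H := hat_nonneg a m b e y Hm He); specialize (EH y); lra) x).
assert (D := represented_difference (psi x) G F r _ _ Hg ltac:(unfold r; lra) Htail HG HF (HR _ HG x) (HR _ HF x)).
replace (fun y => plateau r y * (F y - G y)) with (hat a m b e) in D.
- lra.
- apply functional_extensionality. intros y. rewrite EH.
  destruct (Rle_dec a y) as [Y1|Y1]; [destruct (Rle_dec y (b + e)) as [Y2|Y2]|].
  + rewrite plateau_one by (unfold r; lra). ring.
  + rewrite hat_out by (auto; lra). ring.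
  + rewrite hat_out by (auto; lra). ring.
Qed.

Theorem theorem5 :
  (forall Psi : Conv -> Conv,
     epi_continuous Psi /\ additive Psi ->
     exists psi : R -> R -> R, admissible psi /\ represents psi Psi) /\
  (forall psi : R -> R -> R,
     admissible psi ->
     exists Psi : Conv -> Conv,
       (epi_continuous Psi /\ additive Psi) /\ represents psi Psi /\
       (forall Psi' : Conv -> Conv,
          epi_continuous Psi' -> represents psi Psi' ->
          forall (f : Conv) (x : R), Psi' f x = Psi f x)) /\
  (forall (Psi : Conv -> Conv) (psi : R -> R -> R),
     epi_continuous Psi /\ additive Psi ->
     admissible psi -> represents psi Psi ->
     (monotone Psi <-> (forall x : R, convex_fun (psi x)))).
Proof.
split; [|split].
- intros Psi [HC HA]. exact (representation_exists Psi HC HA).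
- intros psi Hadm. destruct (operator_exists psi Hadm) as [Psi [[HC HA] HR]].
  exists Psi. split; [auto|]. split; [exact HR|].
  intros Psi' HC' HR'. exact (operator_unique psi Psi Psi' HC HR HC' HR').
- intros Psi psi [HC HA] Hadm HR. split.
  + exact (convex_of_monotone Psi psi Hadm HR).
  + exact (monotone_of_convex Psi psi HC Hadm HR).
Qed.
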